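(* Assume that (i) the cost sequence $(c_i)_{i\ge 1}$ is nonnegative and nondecreasing, and (ii) $\sum_{i=1}^\infty c_i q^i<\infty$. Then the single-user model described in the context is threshold-indexable under the average criterion, with Whittle index given by the average-criterion marginal productivity (MP) index $m_{(1,i)}$, i.e., $\nu^*_{(1,i)}=m_{(1,i)}$ for every $i\ge 1$.
   Context: Single-user model. Fix $\lambda\in(0,1]$ (packet arrival probability) and $\mu\in(0,1]$ (transmission success probability); put $p=\lambda\mu$, $q=1-p$, $\mathbb N=\{1,2,\dots\}$. A controlled Markov chain $Y(t)=(B(t),X(t))$, $t=0,1,\dots$, lives on $\{0,1\}\times\mathbb N$; $X(t)$ is the Age of Information (AoI), and $B(t)=1$ iff a packet has just been generated. Actions are $A(t)\in\{0,1\}$ ($1$ = attempt transmission, $0$ = do not). In states $(0,i)$ only action $0$ is available; in states $(1,i)$ both are. Transitions: if $Y(t)=(b,i)$ and $A(t)=0$, then $X(t+1)=i+1$; if $Y(t)=(1,i)$ and $A(t)=1$, then $X(t+1)=1$ with probability $\mu$ and $X(t+1)=i+1$ with probability $1-\mu$. In all cases $B(t+1)$ equals $1$ with probability $\lambda$ and $0$ with probability $1-\lambda$, independently of $X(t+1)$. The cost in a slot with AoI $i$ is $c_i$. Let $\Pi$ be the class of stationary policies (the action choice is based only on the current state). For a policy $\pi$ and initial state $(b,i)$, the average cost and work metrics are $F_{(b,i)}^\pi=\limsup_{T\to\infty}\frac1T\mathbb E_{(b,i)}^\pi[\sum_{t=0}^T c_{X(t)}]$ and $G_{(b,i)}^\pi=\limsup_{T\to\infty}\frac1T\mathbb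 E_{(b,i)}^\pi[\sum_{t=0}^T A(t)]$ (for the threshold policies below these are limits). For a transmission attempt charge $\nu\in\mathbb R$, the single-user subproblem under the average criterion is to minimize $F_{(b,i)}^\pi+\nu G_{(b,i)}^\pi$ over $\pi\in\Pi$. Threshold policies. For a nonnegative integer $k\ge0$, the $k$-threshold policy ($k$-policy) attempts to transmit a packet in state $(1,j)$ if and only if $j>k$. MP index. For $\beta\in(0,1)$, a policy $\pi$ and initial state $(b,i)$ put $F_{\beta,(b,i)}^\pi=\mathbb E_{(b,i)}^\pi[\sum_{t\ge0}c_{X(t)}\beta^t]$ and $G_{\beta,(b,i)}^\pi=\mathbb E_{(b,i)}^\pi[\sum_{t\ge0}A(t)\beta^t]$. For an integer $k\ge0$ and $a\in\{0,1\}$, let $\langle a,k\rangle$ be the policy that takes action $a$ at $t=0$ and follows the $k$-policy from $t=1$ onward. Put $f_{\beta,(1,i)}^k=F_{\beta,(1,i)}^{\langle0,k\rangle}-F_{\beta,(1,i)}^{\langle1,k\rangle}$ and $g_{\beta,(1,i)}^k=G_{\beta,(1,i)}^{\langle1,k\rangle}-G_{\beta,(1,i)}^{\langle0,k\rangle}$ for $i\ge1$. The average-criterion marginal cost and work metrics are $f_{(1,i)}^k=\lim_{\beta\to1}f_{\beta,(1,i)}^k$ and $g_{(1,i)}^k=\lim_{\beta\to1}g_{\beta,(1,i)}^k$ (the latter is positive), and the average-criterion MP index is $m_{(1,i)}=f_{(1,i)}^i/g_{(1,i)}^i$. Indexability. The model is indexable under the average criterion if for each AoI $j\in\mathbb N$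 there exists a critical transmission attempt charge $\nu^*_{(1,j)}$, called the Whittle index, which characterizes the optimal policies for the average-criterion subproblem under any $\nu\in\mathbb R$ as follows: in state $(1,j)$ it is optimal, for any initial state $(b,i)$, to attempt to transmit if and only if $\nu^*_{(1,j)}\ge\nu$, and it is optimal not to attempt to transmit if and only if $\nu^*_{(1,j)}\le\nu$. Threshold-indexability. The model is threshold-indexable under the average criterion if it is indexable and, moreover, threshold policies are optimal for the average-criterion subproblem for any $\nu\in\mathbb R$.
   Formalization: Threshold policies include the infinite threshold (never attempt), needed e.g. for constant costs and positive charge; an action is ''optimal in (1,j)'' if used by an average-optimal policy that also satisfies the dynamic programming equations, as average optimality ignores transient states. *)

(* Defs.v *)
From HB Require Import structures.
From mathcomp Require Import all_boot all_order all_algebra.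
From mathcomp Require Import all_classical all_reals all_analysis.

Set Implicit Arguments.
Unset Strict Implicit.
Unset Printing Implicit Defensive.

Import Order.TTheory GRing.Theory Num.Theory.
Import numFieldNormedType.Exports.

Local Open Scope classical_set_scope.
Local Open Scope ring_scope.

(* A state is a pair (b, i) of the packet indicator and the AoI.  The AoI takes
   the values 1, 2, ...; it never becomes 0 when started from i >= 1, and every
   quantification over states below carries the restriction 0 < i. *)
Definition state := (bool * nat)%type.

Section SingleUser.
Context {R : realType}.
Variables (lambda mu : R) (c : nat -> R).

(* Mean of v (B(t+1), x), where B(t+1) is Bernoulli(lambda). *)
Definition arrival_mean (v : state -> R) (x : nat) : R :=
  lambda * v (true, x) + (1 - lambda) * v (false, x).

(* E[v(Y(t+1)) | Y(t) = s, A(t) = a]; the action a = true is only ever used in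
   states (1, i). *)
Definition trans_mean (s : state) (a : bool) (v : state -> R) : R :=
  if s.1 && a then mu * arrival_mean v 1 + (1 - mu) * arrival_mean v s.2.+1
  else arrival_mean v s.2.+1.

(* Only action 0 being available in states (0, i), a stationary policy amounts
   to the probabilities sigma i of attempting in (1, i). *)
Definition stationary (sigma : nat -> R) : Prop :=
  forall i, (0 < i)%N -> 0 <= sigma i <= 1.

(* Mean of g A for the action A drawn in state s. *)
Definition act_mean (sigma : nat -> R) (s : state) (g : bool -> R) : R :=
  if s.1 then sigma s.2 * g true + (1 - sigma s.2) * g false else g false.

(* E_s^pi[g(Y(t), A(t))] for a policy pi that uses the attempt probabilities
   pi u at time u.  As every state has finitely many successors, this is
   computed by conditioning on the first transition. *)
Fixpoint mean_at (pi : nat -> nat -> R) (g : state -> bool -> R) (t : nat)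
    (s : state) {struct t} : R :=
  match t with
  | 0 => act_mean (pi 0%N) s (g s)
  | t'.+1 => act_mean (pi 0%N) s (fun a =>
      trans_mean s a (mean_at (fun u => pi u.+1) g t'))
  end.

Definition aoi_cost (s : state) (a : bool) : R := c s.2.
Definition attempt (s : state) (a : bool) : R := a%:R.

(* Average criterion. *)

Definition long_run_average (g : state -> bool -> R) (sigma : nat -> R)
    (s : state) : \bar R :=
  limn_esup (fun T : nat =>
    (T%:R^-1 * \sum_(0 <= t < T.+1) mean_at (fun=> sigma) g t s)%:E).

Definition avg_cost (sigma : nat -> R) (s : state) : \bar R :=
  long_run_average aoi_cost sigma s.

Definition avg_work (sigma : nat -> R) (s : state) : \bar R :=
  long_run_average attempt sigma s.

Definition avg_objective (nu : R) (sigma : nat -> R) (s : state) : \bar R :=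
  (avg_cost sigma s + nu%:E * avg_work sigma s)%E.

Definition avg_optimal (nu : R) (sigma : nat -> R) : Prop :=
  stationary sigma /\
  forall tau, stationary tau -> forall b i, (0 < i)%N ->
    (avg_objective nu sigma (b, i) <= avg_objective nu tau (b, i))%E.

Definition q_value (nu eta : R) (h : state -> R) (s : state) (a : bool) : R :=
  c s.2 + nu * a%:R - eta + trans_mean s a h.

(* Dynamic programming equations of the average-criterion subproblem. *)
Definition average_optimality_equations (nu eta : R) (h : state -> R) : Prop :=
  forall i, (0 < i)%N ->
    h (false, i) = q_value nu eta h (false, i) false /\
    h (true, i) = Num.min (q_value nu eta h (true, i) false)
                          (q_value nu eta h (true, i) true).

(* An optimal policy that moreover takes minimizing actions in all states,
   transient ones included. *)
Definition canonical_optimal (nu : R) (sigma : nat -> R) : Prop :=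
  avg_optimal nu sigma /\
  exists eta h,
    [/\ forall b i, (0 < i)%N -> avg_objective nu sigma (b, i) = eta%:E,
        average_optimality_equations nu eta h &
        forall b i, (0 < i)%N ->
          h (b, i) = act_mean sigma (b, i) (q_value nu eta h (b, i))].

(* "In state (1, j) it is optimal, for any initial state, to take action a."
   Average optimality alone does not constrain the actions in states that the
   policy visits with zero frequency: when c is constant and nu > 0, attempting
   in (1, 1) only is as good, for q > 0, as never attempting.  Hence the action
   is required to be that of a canonical optimal policy, i.e., to be optimal in
   the sense of dynamic programming. *)
Definition optimal_action (nu : R) (a : bool) (j : nat) : Prop :=
  exists sigma, canonical_optimal nu sigma /\ sigma j = a%:R.

Definition whittle_index (nus : nat -> R) : Prop :=
  forall nu j, (0 < j)%N ->
    (optimal_action nu true j <-> nu <= nus j) /\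
    (optimal_action nu false j <-> nus j <= nu).

Definition indexable : Prop := exists nus, whittle_index nus.

Definition threshold (k : nat) : nat -> R := fun j => (k < j)%N%:R.

(* None is the infinite threshold (never attempt), which is needed for the
   charges nu above all index values, e.g., for constant c and nu > 0. *)
Definition ext_threshold (k : option nat) : nat -> R :=
  if k is Some k' then threshold k' else fun=> 0.

Definition threshold_indexable : Prop :=
  indexable /\ forall nu, exists k, avg_optimal nu (ext_threshold k).

(* Marginal productivity index. *)

Definition act_then_threshold (a : bool) (k : nat) : nat -> nat -> R :=
  fun t => if t is 0 then fun=> a%:R else threshold k.

(* By nonnegativity, expectation and summation over t are exchanged. *)
Definition discounted (beta : R) (g : state -> bool -> R)
    (pi : nat -> nat -> R) (s : state) : \bar R :=
  (\sum_(0 <= t <oo) (mean_at pi g t s * beta ^+ t)%:E)%E.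

Definition disc_marginal_cost (k i : nat) (beta : R) : \bar R :=
  (discounted beta aoi_cost (act_then_threshold false k) (true, i)
   - discounted beta aoi_cost (act_then_threshold true k) (true, i))%E.

Definition disc_marginal_work (k i : nat) (beta : R) : \bar R :=
  (discounted beta attempt (act_then_threshold true k) (true, i)
   - discounted beta attempt (act_then_threshold false k) (true, i))%E.

Definition is_mp_index (i : nat) (m : R) : Prop :=
  exists f g : R,
    [/\ disc_marginal_cost i i beta @[beta --> 1^'-] --> f%:E,
        disc_marginal_work i i beta @[beta --> 1^'-] --> g%:E,
        0 < g & m = f / g].

End SingleUser.

(* Main.v *)
Require Import Defs.
From HB Require Import structures.
From mathcomp Require Import all_boot all_order all_algebra.
From mathcomp Require Import all_classical all_reals all_analysis.
From mathcomp Require Import ring lra zify.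

(** Write p = lambda mu, q = 1 - p, S_i = sum_n q^n c_(i+n) and C_k = c_1 + ... + c_k.
    The k-policy has average objective
    eta = p (C_k + S_(k+1) + nu / mu) / (1 + k p), and the index is
    m_k = mu (k p S_(k+1) - C_k), nondecreasing in k.  The value u of the k-policy
    at AoI i relative to AoI 1, averaged over the packet indicator, satisfies
    mu u_(k+1) - nu = (m_k - nu) / (1 + k p) and
    mu u_(k+2) - nu = (m_(k+1) - nu) / (1 + k p), so u solves the optimality
    equation u_i = c_i - eta + u_(i+1) + lambda min(0, nu - mu u_(i+1)) exactly when
    m_k <= nu <= m_(k+1).  When nu exceeds all indices the costs are bounded and
    never attempting is optimal, with u_i = sum_(l<i) (sup c - c_l).

    The u_i may grow so fast that E u(X_T) / T need not vanish under an arbitrary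
    policy; lower bounds come from the costs c_min(i, N), for which u is
    bounded, and N -> oo.  Conversely, a solution of the optimality equation with
    u_1 = 0 and the optimal eta is determined by forward recursion (for q = 0 only
    up to the threshold), which identifies the optimal actions.  For the
    discounted problem,
    f - nu g is the limit of beta mu (V(i+1) - V(1)) - nu, which is
    mu u_(i+1) - nu = (m_i - nu) / (1 + i p). *)

Set Implicit Arguments.
Unset Strict Implicit.
Unset Printing Implicit Defensive.
Import Order.TTheory GRing.Theory Num.Theory.
Import numFieldNormedType.Exports.
Local Open Scope classical_set_scope.
Local Open Scope ring_scope.

(** * Long-run averages and verification *)

Section LimSup.
Context {R : realType}.
Implicit Types (u : nat -> \bar R) (m : nat -> R).

Lemma limn_esup_le_near u x :
  (\forall n \near \oo, (u n <= x)%E) -> (limn_esup u <= x)%E.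
Proof.
move=> ux; rewrite /limn_esup limf_esupE.
apply: (@le_trans _ _ (ereal_sup (u @` [set n | (u n <= x)%E]))).
  by apply: ereal_inf_lbound; exists [set n | (u n <= x)%E].
by apply: ge_ereal_sup => _ [n /= un <-].
Qed.

Lemma limn_esup_lt_near u x :
  (limn_esup u < x)%E -> \forall n \near \oo, (u n < x)%E.
Proof.
rewrite /limn_esup limf_esupE => /ereal_inf_lt[_ [V FV <-]] ltx.
apply: filterS FV => n Vn; apply: le_lt_trans ltx.
by apply: ereal_sup_ubound; exists n.
Qed.

Lemma limn_esup_ge_near u x :
  (\forall n \near \oo, (x <= u n)%E) -> (x <= limn_esup u)%E.
Proof.
move=> xu; rewrite leNgt; apply/negP => /limn_esup_lt_near ux.
have [n [xun uxn]] := filter_ex (filterI xu ux).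
by move: (le_lt_trans xun uxn); rewrite ltxx.
Qed.

Lemma cesaro_near_le m eta M :
  (forall T, \sum_(0 <= t < T) m t <= T%:R * eta + M) ->
  forall e, 0 < e ->
  \forall T \near \oo, T%:R^-1 * \sum_(0 <= t < T.+1) m t <= eta + e.
Proof.
move=> mM e e0; near=> T.
have T0 : 0 < T%:R :> R by rewrite ltr0n; near: T; exists 1%N.
rewrite mulrC ler_pdivrMr//; apply: le_trans (mM _) _.
(* The average divides T + 1 terms by T, so its excess over eta is at most (eta + M) / T. *)
have : (eta + M) / e <= T%:R.
  near: T; exists (Num.bound `|(eta + M) / e|) => // n /= nb.
  apply: (le_trans (ler_norm _)); apply/ltW.
  by apply: lt_le_trans (archi_boundP (normr_ge0 _)) _; rewrite ler_nat.
rewrite ler_pdivrMr// -natr1 => h; nra.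
Unshelve. all: by end_near. Qed.

Lemma cesaro_near_ge m eta M :
  (forall T, T%:R * eta - M <= \sum_(0 <= t < T) m t) ->
  forall e, 0 < e ->
  \forall T \near \oo, eta - e <= T%:R^-1 * \sum_(0 <= t < T.+1) m t.
Proof.
move=> mM e e0.
have /cesaro_near_le/(_ e e0) : forall T, \sum_(0 <= t < T) - m t <= T%:R * - eta + M.
  by move=> T; rewrite sumrN; have := mM T; lra.
by apply: filterS => T; rewrite sumrN mulrN; lra.
Qed.

End LimSup.

(** * Expectations along the chain and telescoping of one-step inequalities *)

Section Means.
Context {R : realType}.
Variables (lambda mu : R).
Hypotheses (hlambda : 0 < lambda <= 1) (hmu : 0 < mu <= 1).
Implicit Types (sigma : nat -> R) (g : state -> bool -> R) (v : state -> R).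

Let lambda_ge0 : 0 <= lambda. Proof. by case/andP: hlambda => /ltW. Qed.
Let lambda_le1 : lambda <= 1. Proof. by case/andP: hlambda. Qed.
Let mu_ge0 : 0 <= mu. Proof. by case/andP: hmu => /ltW. Qed.
Let mu_le1 : mu <= 1. Proof. by case/andP: hmu. Qed.

Local Notation mean_at := (mean_at lambda mu).
Local Notation trans_mean := (trans_mean lambda mu).

Lemma mean_at0 pi g s : mean_at pi g 0 s = act_mean (pi 0%N) s (g s).
Proof. by []. Qed.

Lemma mean_atS pi g t s : mean_at pi g t.+1 s =
  act_mean (pi 0%N) s (fun a => trans_mean s a (mean_at (fun u => pi u.+1) g t)).
Proof. by []. Qed.

Lemma trans_mean_lin a b v w s e :
  trans_mean s e (fun s' => a * v s' + b * w s') =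
  a * trans_mean s e v + b * trans_mean s e w.
Proof. by rewrite /trans_mean /arrival_mean; case: ifP => _; ring. Qed.

Lemma trans_mean_le s a v w : (forall b i, (0 < i)%N -> v (b, i) <= w (b, i)) ->
  trans_mean s a v <= trans_mean s a w.
Proof.
move=> vw.
have arr i : (0 < i)%N -> arrival_mean lambda v i <= arrival_mean lambda w i.
  move=> i0; by rewrite /arrival_mean lerD// ler_wpM2l ?vw ?subr_ge0.
rewrite /trans_mean; case: ifP => _; last exact: arr.
by rewrite lerD// ler_wpM2l ?arr ?subr_ge0.
Qed.

Lemma act_mean_le sigma s (f g : bool -> R) : stationary sigma ->
  (0 < s.2)%N -> (forall a, f a <= g a) -> act_mean sigma s f <= act_mean sigma s g.
Proof.
move=> st s0 fg; rewrite /act_mean; case: ifP => // _.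
by case/andP: (st _ s0) => sp sp1; rewrite lerD// ler_wpM2l ?subr_ge0.
Qed.

Lemma mean_at_lin pi a b g g' t s :
  mean_at pi (fun s e => a * g s e + b * g' s e) t s =
  a * mean_at pi g t s + b * mean_at pi g' t s.
Proof.
elim: t pi s => [|t IH] pi s.
  by rewrite !mean_at0 /act_mean; case: ifP => _; ring.
rewrite !mean_atS /act_mean.
have -> : mean_at (fun u => pi u.+1) (fun s e => a * g s e + b * g' s e) t =
  fun s => a * mean_at (fun u => pi u.+1) g t s + b * mean_at (fun u => pi u.+1) g' t s.
  by apply/funext => s'; apply: IH.
by rewrite !trans_mean_lin; case: ifP => _; ring.
Qed.

Lemma mean_at_le sigma g g' t b i : stationary sigma -> (0 < i)%N ->
  (forall b i a, (0 < i)%N -> g (b, i) a <= g' (b, i) a) ->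
  mean_at (fun=> sigma) g t (b, i) <= mean_at (fun=> sigma) g' t (b, i).
Proof.
move=> st i0 gg; elim: t b i i0 => [|t IH] b i i0.
  by rewrite !mean_at0; apply: act_mean_le => // a; apply: gg.
rewrite !mean_atS; apply: act_mean_le => // a; apply: trans_mean_le => b' i' i'0.
exact: IH.
Qed.

Lemma act_mean_const sigma s (x : R) : act_mean sigma s (fun=> x) = x.
Proof. by rewrite /act_mean; case: ifP => _ //; ring. Qed.

Lemma mean_at_const sigma (x : R) t s : mean_at (fun=> sigma) (fun _ _ => x) t s = x.
Proof.
elim: t s => [|t IH] s; first by rewrite mean_at0 act_mean_const.
rewrite mean_atS.
have -> : (fun a => trans_mean s a (mean_at (fun=> sigma) (fun _ _ => x) t)) = fun=> x.
  by apply/funext => a; rewrite /trans_mean /arrival_mean !IH; case: ifP => _; ring.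
exact: act_mean_const.
Qed.

(** The hypothesis is the case t = 0. As [mean_at] peels off the first transition, later times
    follow from monotonicity of the one-step means. *)
Lemma mean_at_subsolution sigma g v beta eta : stationary sigma ->
  (forall b i, (0 < i)%N -> v (b, i) <= act_mean sigma (b, i)
     (fun a => g (b, i) a - eta + beta * trans_mean (b, i) a v)) ->
  forall t b i, (0 < i)%N ->
  mean_at (fun=> sigma) (fun s _ => v s) t (b, i) <=
  mean_at (fun=> sigma) g t (b, i) - eta +
    beta * mean_at (fun=> sigma) (fun s _ => v s) t.+1 (b, i).
Proof.
move=> st sub; elim=> [|t IH] b i i0.
  have mv0 : mean_at (fun=> sigma) (fun s _ => v s) 0 = v.
    by apply/funext => s; rewrite mean_at0 act_mean_const.
  rewrite mean_atS mv0; apply: le_trans (sub _ _ i0) _.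
  rewrite mean_at0 /act_mean; case: ifP => _; rewrite le_eqVlt; apply/orP; left; apply/eqP; ring.
rewrite mean_atS (mean_atS _ _ t) mean_atS.
set V := mean_at _ _ t; set G := mean_at _ g t; set V' := mean_at _ _ t.+1.
have VV a : trans_mean (b, i) a V <=
    trans_mean (b, i) a G - eta + beta * trans_mean (b, i) a V'.
  (* The bound is written as a combination of [G], the constant 1 and [V'] so that [trans_mean_lin]
     splits it. *)
  have := @trans_mean_le (b, i) a V (fun s => 1 * (1 * G s + (- eta) * 1) + beta * V' s).
  rewrite !trans_mean_lin.
  have -> : trans_mean (b, i) a (fun=> 1) = 1.
    by rewrite /trans_mean /arrival_mean; case: ifP => _; ring.
  rewrite !mul1r mulr1; apply => b' i' i'0; by rewrite ?mulr1 ?mul1r; exact: IH.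
apply: le_trans (act_mean_le st _ VV) _ => //.
rewrite /act_mean; case: ifP => _; rewrite le_eqVlt; apply/orP; left; apply/eqP; ring.
Qed.

(** Weighted by beta^t, the one-step inequalities telescope. The average criterion takes beta = 1,
    the discounted one beta < 1. *)
Lemma mean_sum_subsolution sigma g v beta eta T b i : stationary sigma ->
  0 <= beta ->
  (forall b i, (0 < i)%N -> v (b, i) <= act_mean sigma (b, i)
     (fun a => g (b, i) a - eta + beta * trans_mean (b, i) a v)) ->
  (0 < i)%N ->
  v (b, i) <= \sum_(0 <= t < T) (mean_at (fun=> sigma) g t (b, i) - eta) * beta ^+ t +
    beta ^+ T * mean_at (fun=> sigma) (fun s _ => v s) T (b, i).
Proof.
move=> st b0 sub i0; elim: T => [|T IH].
  by rewrite big_geq// expr0 mul1r add0r mean_at0 act_mean_const.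
apply: (le_trans IH); rewrite big_nat_recr // -addrA lerD2l exprS.
have := mean_at_subsolution st sub T b i0; move/(ler_wpM2l (exprn_ge0 T b0)).
by move/le_trans; apply; rewrite le_eqVlt; apply/orP; left; apply/eqP; ring.
Qed.

(** Obtained from the subsolution case by negating [g], [v] and [eta]. *)
Lemma mean_sum_supersolution sigma g v beta eta T b i : stationary sigma ->
  0 <= beta ->
  (forall b i, (0 < i)%N -> act_mean sigma (b, i)
     (fun a => g (b, i) a - eta + beta * trans_mean (b, i) a v) <= v (b, i)) ->
  (0 < i)%N ->
  \sum_(0 <= t < T) (mean_at (fun=> sigma) g t (b, i) - eta) * beta ^+ t +
    beta ^+ T * mean_at (fun=> sigma) (fun s _ => v s) T (b, i) <= v (b, i).
Proof.
move=> st b0 sup i0.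
have Nlin (h : state -> bool -> R) t s :
    mean_at (fun=> sigma) (fun s a => - h s a) t s = - mean_at (fun=> sigma) h t s.
  have -> : (fun s a => - h s a) = (fun s a => (-1) * h s a + 0 * h s a).
    by apply/funext => ?; apply/funext => ?; ring.
  by rewrite mean_at_lin; ring.
have Nsub b' i' : (0 < i')%N -> - v (b', i') <= act_mean sigma (b', i')
     (fun a => - g (b', i') a - (- eta) + beta * trans_mean (b', i') a (fun s => - v s)).
  move=> i'0; have := sup b' i' i'0; rewrite -lerN2 => /le_trans; apply.
  have tN a : trans_mean (b', i') a (fun s => - v s) = - trans_mean (b', i') a v.
    by rewrite /trans_mean /arrival_mean; case: ifP => _; ring.
  by rewrite /act_mean !tN; case: ifP => _; rewrite le_eqVlt; apply/orP; left; apply/eqP; ring.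
have := @mean_sum_subsolution sigma (fun s a => - g s a) (fun s => - v s) beta (- eta)
  T b i st b0 Nsub i0.
rewrite Nlin.
under eq_bigr => t _ do rewrite Nlin -opprD mulNr.
by rewrite sumrN; lra.
Qed.

End Means.

(** * Geometrically weighted tail sums *)

Section TailSum.
Context {R : realType}.
Implicit Types (r : R) (c : nat -> R).

Definition nonneg_nondecreasing c :=
  (forall i, (0 < i)%N -> 0 <= c i) /\
  forall i j, (0 < i)%N -> (i <= j)%N -> c i <= c j.

Definition partial_sum r c x N : R := \sum_(0 <= n < N) r ^+ n * c (x + n)%N.

Definition tail_sum r c x : R := limn (partial_sum r c x).

(** Bounds are asked from every start x, so that shifting the start never divides by r, which is 0
    when lambda = mu = 1 and r = q. *)
Definition tail_summable r c :=
  forall x, (0 < x)%N -> exists M, forall N, partial_sum r c x N <= M.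

Lemma partial_sumS r c x N :
  partial_sum r c x N.+1 = c x + r * partial_sum r c x.+1 N.
Proof.
rewrite /partial_sum big_nat_recl // expr0 mul1r addn0 mulr_sumr.
by congr (_ + _); apply: eq_bigr => n _; rewrite exprS mulrA addnS addSn.
Qed.

Lemma partial_sum_ge0 r c x N : 0 <= r -> nonneg_nondecreasing c -> (0 < x)%N ->
  0 <= partial_sum r c x N.
Proof.
move=> r0 [c0 _] x0; apply: sumr_ge0 => n _.
by rewrite mulr_ge0 ?exprn_ge0// c0// addn_gt0 x0.
Qed.

Lemma ler_partial_sum r r' c c' x N : 0 <= r <= r' -> nonneg_nondecreasing c' ->
  (0 < x)%N -> (forall i, (0 < i)%N -> 0 <= c i <= c' i) ->
  partial_sum r c x N <= partial_sum r' c' x N.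
Proof.
move=> /andP[r0 rr'] [c0 _] x0 cc'; apply: ler_sum => n _.
have xn0 : (0 < x + n)%N by rewrite addn_gt0 x0.
have /andP[? ?] := cc' _ xn0.
by apply: ler_pM; rewrite ?exprn_ge0// lerXn2r// nnegrE (le_trans r0).
Qed.

Lemma partial_sum_homo r c x : 0 <= r -> nonneg_nondecreasing c -> (0 < x)%N ->
  {homo partial_sum r c x : m n / (m <= n)%N >-> m <= n}.
Proof.
move=> r0 [c0 _] x0; apply: homo_leq; [by []|exact: le_trans|].
move=> n; rewrite /partial_sum big_nat_recr//= lerDl mulr_ge0 ?exprn_ge0//.
by rewrite c0// addn_gt0 x0.
Qed.

Lemma tail_sum_cvg r c x : 0 <= r -> nonneg_nondecreasing c ->
  tail_summable r c -> (0 < x)%N -> cvgn (partial_sum r c x).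
Proof.
move=> r0 hc hs x0; apply: nondecreasing_is_cvgn; first exact: partial_sum_homo.
by have [M MP] := hs _ x0; exists M => _ [N _ <-].
Qed.

Lemma partial_sum_le_tail r c x N : 0 <= r -> nonneg_nondecreasing c ->
  tail_summable r c -> (0 < x)%N -> partial_sum r c x N <= tail_sum r c x.
Proof.
move=> r0 hc hs x0; apply: nondecreasing_cvgn_le; first exact: partial_sum_homo.
exact: tail_sum_cvg.
Qed.

Lemma tail_sum_le r c x M : 0 <= r -> nonneg_nondecreasing c ->
  tail_summable r c -> (0 < x)%N -> (forall N, partial_sum r c x N <= M) ->
  tail_sum r c x <= M.
Proof.
move=> r0 hc hs x0 leM; apply: limr_le; first exact: tail_sum_cvg.
by near=> N; exact: leM.
Unshelve. all: by end_near. Qed.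

Lemma tail_sum_approx r c x e : 0 <= r -> nonneg_nondecreasing c ->
  tail_summable r c -> (0 < x)%N -> 0 < e ->
  exists N, tail_sum r c x - e < partial_sum r c x N.
Proof.
move=> r0 hc hs x0 e0; apply: contrapT => /forallNP noN.
have : tail_sum r c x <= tail_sum r c x - e.
  by apply: tail_sum_le => // N; rewrite leNgt; apply/negP/noN.
lra.
Qed.

Lemma tail_sumE r c x : 0 <= r -> nonneg_nondecreasing c ->
  tail_summable r c -> (0 < x)%N ->
  tail_sum r c x = c x + r * tail_sum r c x.+1.
Proof.
move=> r0 hc hs x0; apply/eqP; rewrite eq_le; apply/andP; split.
  apply: tail_sum_le => // -[|N].
    rewrite /partial_sum big_geq// addr_ge0 ?mulr_ge0 ?hc.1//.
    exact: le_trans (partial_sum_ge0 0 r0 hc _) (partial_sum_le_tail 0 r0 hc hs _).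
  by rewrite partial_sumS lerD2l ler_wpM2l// partial_sum_le_tail.
(* Each partial sum of S_(x+1) is to be bounded by (S_x - c_x) / r, whence the separate case r =
   0. *)
rewrite addrC -lerBrDr; have [r00|rn0] := eqVneq r 0.
  have := partial_sum_le_tail 1 r0 hc hs x0.
  by rewrite partial_sumS r00 !mul0r addr0 subr_ge0.
have rp : 0 < r by rewrite lt_def rn0.
rewrite mulrC -ler_pdivlMr//; apply: tail_sum_le => // N.
rewrite ler_pdivlMr// mulrC.
by have := partial_sum_le_tail N.+1 r0 hc hs x0; rewrite partial_sumS; lra.
Qed.

Lemma tail_sum_homo r c x y : 0 <= r -> nonneg_nondecreasing c ->
  tail_summable r c -> (0 < x)%N -> (x <= y)%N -> tail_sum r c x <= tail_sum r c y.
Proof.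
move=> r0 hc hs x0 xy; have y0 := leq_trans x0 xy.
apply: tail_sum_le => // N; apply: le_trans (partial_sum_le_tail N r0 hc hs y0).
apply: ler_sum => n _; rewrite ler_wpM2l ?exprn_ge0// hc.2 ?leq_add2r//.
by rewrite addn_gt0 x0.
Qed.

(** S_x = c_x + r S_(x+1) >= c_x + r S_x, as S is nondecreasing. For r = q this reads c_x <= p S_x,
    the inequality behind the monotonicity of the index. *)
Lemma tail_sum_ge r c x : 0 <= r -> nonneg_nondecreasing c ->
  tail_summable r c -> (0 < x)%N -> c x <= (1 - r) * tail_sum r c x.
Proof.
move=> r0 hc hs x0; have := tail_sumE r0 hc hs x0.
have := ler_wpM2l r0 (tail_sum_homo r0 hc hs x0 (leqnSn x)); lra.
Qed.

Lemma tail_sum_ge0 r c x : 0 <= r -> nonneg_nondecreasing c ->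
  tail_summable r c -> (0 < x)%N -> 0 <= tail_sum r c x.
Proof.
move=> r0 hc hs x0; apply: le_trans (partial_sum_le_tail 0 r0 hc hs x0).
by rewrite /partial_sum big_geq.
Qed.

Lemma tail_summable_le r r' c c' : 0 <= r <= r' -> nonneg_nondecreasing c' ->
  (forall i, (0 < i)%N -> 0 <= c i <= c' i) ->
  tail_summable r' c' -> tail_summable r c.
Proof.
move=> rr' hc' cc' hs x x0; have [M MP] := hs x x0; exists M => N.
exact: le_trans (ler_partial_sum N rr' hc' x0 cc') (MP N).
Qed.

Lemma ler_tail_sum r r' c c' x : 0 <= r <= r' -> nonneg_nondecreasing c ->
  nonneg_nondecreasing c' -> (forall i, (0 < i)%N -> 0 <= c i <= c' i) ->
  tail_summable r' c' -> (0 < x)%N -> tail_sum r c x <= tail_sum r' c' x.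
Proof.
move=> rr' hc hc' cc' hs x0; case/andP: (rr') => r0 rler'.
apply: tail_sum_le => //; first exact: tail_summable_le hs.
move=> N; apply: le_trans (ler_partial_sum N rr' hc' x0 cc') _.
by apply: partial_sum_le_tail => //; exact: le_trans rler'.
Qed.

Definition truncate (N : nat) c : nat -> R := fun i => c (minn i N).

Lemma truncate_le N c i : nonneg_nondecreasing c -> (0 < N)%N -> (0 < i)%N ->
  0 <= truncate N c i <= c i.
Proof.
move=> [c0 cle] N0 i0; have m0 : (0 < minn i N)%N by rewrite leq_min i0.
by rewrite /truncate c0//= cle// geq_minl.
Qed.

Lemma truncate_nonneg_nondecreasing N c :
  nonneg_nondecreasing c -> (0 < N)%N -> nonneg_nondecreasing (truncate N c).
Proof.
move=> hc N0; split=> [i i0|i j i0 ij]; first by case/andP: (truncate_le hc N0 i0).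
by apply: hc.2; lia.
Qed.

(** Truncation only lowers tail sums, and for large N it leaves unchanged a partial sum that is
    already within e of the limit. *)
Lemma tail_sum_truncate_cvg r c x : 0 <= r -> nonneg_nondecreasing c ->
  tail_summable r c -> (0 < x)%N ->
  tail_sum r (truncate N c) x @[N --> \oo] --> tail_sum r c x.
Proof.
move=> r0 hc hs x0; apply/cvgrPdist_le => e e0.
have [M MP] := tail_sum_approx r0 hc hs x0 e0.
near=> N; have N0 : (0 < N)%N by near: N; exists 1%N.
have hcN := truncate_nonneg_nondecreasing hc N0.
have rr : 0 <= r <= r by rewrite r0 /=.
have hsN := tail_summable_le rr hc (fun i => truncate_le hc N0) hs.
rewrite ger0_norm ?subr_ge0; last first.
  exact: ler_tail_sum (fun i => truncate_le hc N0) _ _.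
have eqM : partial_sum r c x M = partial_sum r (truncate N c) x M.
  apply: eq_big_nat => n /andP[_ nM]; congr (_ * c _).
  have xMN : (x + M <= N)%N by near: N; exists (x + M)%N.
  by apply/esym/minn_idPl; apply: leq_trans xMN; rewrite leq_add2l ltnW.
by have := partial_sum_le_tail M r0 hcN hsN x0; rewrite -eqM; lra.
Unshelve. all: by end_near. Qed.

Lemma tail_sum_truncate_bound r c N x : 0 <= r < 1 -> nonneg_nondecreasing c ->
  tail_summable r c -> (0 < N)%N -> (0 < x)%N ->
  tail_sum r (truncate N c) x <= c N / (1 - r).
Proof.
move=> /andP[r0 r1] hc hs N0 x0.
have hcN := truncate_nonneg_nondecreasing hc N0.
have rr : 0 <= r <= r by rewrite r0 /=.
apply: tail_sum_le => //; first exact: tail_summable_le (fun i => truncate_le hc N0) hs.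
move=> M; apply: (@le_trans _ _ (\sum_(0 <= n < M) r ^+ n * c N)).
  apply: ler_sum => n _; rewrite ler_wpM2l ?exprn_ge0//.
  by apply: hc.2; lia.
rewrite -mulr_suml mulrC ler_wpM2l ?hc.1// -div1r ler_pdivlMr ?subr_gt0//.
have := subrX1 r M; rewrite (big_mkord xpredT (fun n => r ^+ n)) => rX.
have := exprn_ge0 M r0; set s := \sum_(_ < _) _ in rX *; lra.
Qed.

(** Abel's theorem for nonnegative terms: the sum at r beta is at most the sum at r, and at least a
    partial sum that is polynomial in beta and nearly exhausts the limit. *)
Lemma tail_sum_discount_cvg r c x : 0 <= r -> nonneg_nondecreasing c ->
  tail_summable r c -> (0 < x)%N ->
  tail_sum (r * beta) c x @[beta --> 1^'-] --> tail_sum r c x.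
Proof.
move=> r0 hc hs x0; apply/cvgrPdist_le => e e0.
have e20 : 0 < e / 2 by lra.
have [M MP] := tail_sum_approx r0 hc hs x0 e20.
have : (partial_sum (r * beta) c x M) @[beta --> (1:R)] --> partial_sum (r * 1) c x M.
  apply: cvg_big => [|n _]; first exact: add_continuous.
  apply: cvgMr_tmp.
  apply: (@cvg_comp _ _ _ (fun b : R => r * b) (fun y : R => y ^+ n)).
    exact: mulrl_continuous.
  exact: exprn_continuous.
rewrite mulr1 => /cvg_at_left_filter /cvgrPdist_le /(_ _ e20) pcv.
near=> b.
have b0 : 0 <= b by apply/ltW; near: b; exact: nbhs_left_gt.
have b1 : b <= 1 by apply/ltW; near: b; exact: nbhs_left_lt.
have rr : 0 <= r * b <= r by rewrite mulr_ge0//= ler_piMr.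
have cc i : (0 < i)%N -> 0 <= c i <= c i by move=> i0; rewrite hc.1//=.
have hsb := tail_summable_le rr hc cc hs.
rewrite ger0_norm ?subr_ge0; last exact: ler_tail_sum cc _ _.
have : `|partial_sum r c x M - partial_sum (r * b) c x M| <= e / 2 by near: b.
rewrite ler_norml; case/andP: rr => rb0 _.
have := partial_sum_le_tail M rb0 hc hsb x0; lra.
Unshelve. all: by end_near. Qed.

End TailSum.

(** * Verification bounds for long-run averages *)

Section Averages.
Context {R : realType}.
Variables (lambda mu : R).
Hypotheses (hlambda : 0 < lambda <= 1) (hmu : 0 < mu <= 1).
Implicit Types (sigma : nat -> R) (g : state -> bool -> R) (v : state -> R).

Local Notation mean_at := (mean_at lambda mu).
Local Notation trans_mean := (trans_mean lambda mu).
Local Notation long_run_average := (long_run_average lambda mu).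

Lemma long_run_average_le g sigma s eta M :
  (forall T, \sum_(0 <= t < T) mean_at (fun=> sigma) g t s <= T%:R * eta + M) ->
  (long_run_average g sigma s <= eta%:E)%E.
Proof.
move=> gM; apply/lee_addgt0Pr => e e0; apply: limn_esup_le_near.
by apply: filterS (cesaro_near_le gM e0) => T; rewrite -EFinD lee_fin.
Qed.

Lemma long_run_average_ge g sigma s eta M :
  (forall T, T%:R * eta - M <= \sum_(0 <= t < T) mean_at (fun=> sigma) g t s) ->
  (eta%:E <= long_run_average g sigma s)%E.
Proof.
move=> gM; apply/lee_addgt0Pr => e e0; rewrite -leeBlDr//.
apply: limn_esup_ge_near.
by apply: filterS (cesaro_near_ge gM e0) => T; rewrite -EFinB lee_fin.
Qed.

(** The lower bound on [v] controls the telescoped term E v(Y_T). The dual statement for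
    subsolutions takes an upper bound instead. *)
Lemma average_supersolution sigma g v eta M b i : stationary sigma ->
  (forall b i, (0 < i)%N -> - M <= v (b, i)) ->
  (forall b i, (0 < i)%N -> act_mean sigma (b, i)
     (fun a => g (b, i) a - eta + trans_mean (b, i) a v) <= v (b, i)) ->
  (0 < i)%N -> forall T,
  \sum_(0 <= t < T) mean_at (fun=> sigma) g t (b, i) <= T%:R * eta + (v (b, i) + M).
Proof.
move=> st vM sup i0 T.
have sup1 b' i' : (0 < i')%N -> act_mean sigma (b', i')
    (fun a => g (b', i') a - eta + 1 * trans_mean (b', i') a v) <= v (b', i').
  by move=> i'0; have := sup b' i' i'0; rewrite /act_mean !mul1r.
have := mean_sum_supersolution hlambda hmu T b st ler01 sup1 i0.
have : - M <= mean_at (fun=> sigma) (fun s _ => v s) T (b, i).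
  rewrite -[leLHS](mean_at_const lambda mu sigma (- M) T (b, i)).
  by apply: mean_at_le => // b' i' _; apply: vM.
rewrite expr1n mul1r.
under eq_bigr => t _ do rewrite expr1n mulr1.
by rewrite sumrB sumr_const_nat subn0 -mulr_natl; lra.
Qed.

Lemma average_subsolution sigma g v eta M b i : stationary sigma ->
  (forall b i, (0 < i)%N -> v (b, i) <= M) ->
  (forall b i, (0 < i)%N -> v (b, i) <= act_mean sigma (b, i)
     (fun a => g (b, i) a - eta + trans_mean (b, i) a v)) ->
  (0 < i)%N -> forall T,
  T%:R * eta - (M - v (b, i)) <= \sum_(0 <= t < T) mean_at (fun=> sigma) g t (b, i).
Proof.
move=> st vM sub i0 T.
have sub1 b' i' : (0 < i')%N -> v (b', i') <= act_mean sigma (b', i')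
    (fun a => g (b', i') a - eta + 1 * trans_mean (b', i') a v).
  by move=> i'0; have := sub b' i' i'0; rewrite /act_mean !mul1r.
have := mean_sum_subsolution hlambda hmu T b st ler01 sub1 i0.
have : mean_at (fun=> sigma) (fun s _ => v s) T (b, i) <= M.
  rewrite -[leRHS](mean_at_const lambda mu sigma M T (b, i)).
  by apply: mean_at_le => // b' i' _; apply: vM.
rewrite expr1n mul1r.
under eq_bigr => t _ do rewrite expr1n mulr1.
by rewrite sumrB sumr_const_nat subn0 -mulr_natl; lra.
Qed.

Lemma mean_at_ge0 sigma g t b i : stationary sigma -> (0 < i)%N ->
  (forall b i a, (0 < i)%N -> 0 <= g (b, i) a) ->
  0 <= mean_at (fun=> sigma) g t (b, i).
Proof.
move=> st i0 g0; rewrite -[leLHS](mean_at_const lambda mu sigma 0 t (b, i)).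
exact: mean_at_le.
Qed.

Lemma long_run_average_ge0 sigma g b i : stationary sigma -> (0 < i)%N ->
  (forall b i a, (0 < i)%N -> 0 <= g (b, i) a) ->
  (0 <= long_run_average g sigma (b, i))%E.
Proof.
move=> st i0 g0; apply: (@long_run_average_ge _ _ _ 0 0) => T.
by rewrite mulr0 subr0 sumr_ge0// => t _; exact: mean_at_ge0.
Qed.

Lemma avg_work_le_lambda sigma b i : stationary sigma -> (0 < i)%N ->
  (avg_work lambda mu sigma (b, i) <= lambda%:E)%E.
Proof.
move=> st i0; apply: long_run_average_le.
(* The packet indicator serves as value: an attempt requires the current packet, and the next one
   arrives with probability lambda. *)
apply: (@average_supersolution sigma _ (fun s => s.1%:R) lambda 0) => //.
  by move=> b' i' _; rewrite oppr0 ler0n.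
move=> b' i' i'0; rewrite /act_mean /attempt /trans_mean /arrival_mean/=.
by case: b' => /=; have := st _ i'0; nra.
Qed.

Lemma avg_work_ge0 sigma b i : stationary sigma -> (0 < i)%N ->
  (0 <= avg_work lambda mu sigma (b, i))%E.
Proof. by move=> st i0; apply: long_run_average_ge0 => // *; rewrite ler0n. Qed.

Lemma avg_work_fin_num sigma b i : stationary sigma -> (0 < i)%N ->
  avg_work lambda mu sigma (b, i) \is a fin_num.
Proof.
move=> st i0; rewrite ge0_fin_numE ?avg_work_ge0//.
exact: le_lt_trans (avg_work_le_lambda b st i0) (ltry _).
Qed.

(* The inequality limsup f + nu limsup g >= limsup (f + nu g) requires nu >= 0. *)
Lemma long_run_average_comb_ge sigma f g nu b i eta M : 0 <= nu ->
  stationary sigma -> (0 < i)%N ->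
  (forall b i a, (0 < i)%N -> 0 <= f (b, i) a) ->
  long_run_average g sigma (b, i) \is a fin_num ->
  (forall T, T%:R * eta - M <= \sum_(0 <= t < T)
     mean_at (fun=> sigma) (fun s a => f s a + nu * g s a) t (b, i)) ->
  (eta%:E <= long_run_average f sigma (b, i) +
    nu%:E * long_run_average g sigma (b, i))%E.
Proof.
move=> nu0 st i0 f0 gfin etaM.
have F0 := long_run_average_ge0 b st i0 f0.
move: gfin; rewrite /Defs.long_run_average in F0 *.
set G := limn_esup (fun T => (_ * \sum_(0 <= t < _) mean_at _ g t _)%:E).
set F := limn_esup (fun T => (_ * \sum_(0 <= t < _) mean_at _ f t _)%:E) in F0 *.
move=> Gfin; have [Fy|Fny] := eqVneq F +oo%E.
  by rewrite Fy addye ?leey// -(fineK Gfin) -EFinM.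
have Ffin : F \is a fin_num by rewrite ge0_fin_numE// lt_neqAle Fny leey.
rewrite -(fineK Gfin) -(fineK Ffin) -EFinM -EFinD lee_fin.
(* The errors are d for the cost, nu d for the work and d for the lower bound, in total (2 + nu)
   d. *)
apply/ler_addgt0Pr => e e0; pose d := e / (2 + nu).
have nu2 : 0 < 2 + nu by lra.
have d0 : 0 < d by rewrite divr_gt0.
have Fd : (F < (fine F + d)%:E)%E by rewrite EFinD fineK// lteDl ?lte_fin.
have Gd : (G < (fine G + d)%:E)%E by rewrite EFinD fineK// lteDl ?lte_fin.
have [T [FT [GT ET]]] := filter_ex (filterI (limn_esup_lt_near Fd)
  (filterI (limn_esup_lt_near Gd) (cesaro_near_ge etaM d0))).
move: FT GT ET; rewrite !lte_fin.
have -> : \sum_(0 <= t < T.+1) mean_at (fun=> sigma) (fun s a => f s a + nu * g s a) t (b, i) =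
    \sum_(0 <= t < T.+1) mean_at (fun=> sigma) f t (b, i) +
    nu * \sum_(0 <= t < T.+1) mean_at (fun=> sigma) g t (b, i).
  rewrite mulr_sumr -big_split/=; apply: eq_bigr => t _.
  rewrite -[X in X + _]mul1r -mean_at_lin; congr (Defs.mean_at _ _ _ _ _ _).
  by apply/funext => s; apply/funext => a; rewrite mul1r.
rewrite mulrDr mulrCA => FT GT ET.
have -> : e = (2 + nu) * d by rewrite mulrC divfK// gt_eqF.
by have := ler_wpM2l nu0 (ltW GT); lra.
Qed.

End Averages.

(** * Values of threshold policies *)

Section ThresholdValue.
Context {R : realType}.
Variables (lambda mu beta : R) (c : nat -> R) (k : nat) (nu eta : R).

Local Notation p := (lambda * mu).
Local Notation q := (1 - lambda * mu).
Local Notation S := (tail_sum (q * beta) c).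

Definition stage_cost : state -> bool -> R := fun s a => c s.2 + nu * a%:R.

(* Value, averaged over the packet indicator, of the k-policy at AoI x > k when
   its value at AoI 1 is v1. *)
Definition tail_value (v1 : R) (x : nat) : R :=
  S x + (lambda * nu - eta + p * beta * v1) / (1 - q * beta).

Definition threshold_value (v1 : R) (x : nat) : R :=
  if (x <= k)%N then
    \sum_(x <= l < k.+1) beta ^+ (l - x) * (c l - eta) +
      beta ^+ (k.+1 - x) * tail_value v1 k.+1
  else tail_value v1 x.

Definition threshold_state_value (v1 : R) (s : state) : R :=
  c s.2 - eta +
  (if s.1 && (k < s.2)%N then
     nu + beta * (mu * v1 + (1 - mu) * threshold_value v1 s.2.+1)
   else beta * threshold_value v1 s.2.+1).

Lemma threshold_value_before v1 x : (x <= k)%N ->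
  threshold_value v1 x = c x - eta + beta * threshold_value v1 x.+1.
Proof.
move=> xk; rewrite {1}/threshold_value xk big_ltn ?ltnS// subnn expr0 mul1r.
rewrite -addrA; congr (_ + _); rewrite subSn// exprS.
have -> : \sum_(x.+1 <= l < k.+1) beta ^+ (l - x) * (c l - eta) =
    beta * \sum_(x.+1 <= l < k.+1) beta ^+ (l - x.+1) * (c l - eta).
  rewrite mulr_sumr; apply: eq_big_nat => l /andP[xl _].
  by rewrite mulrA -exprS; congr (_ ^+ _ * _); lia.
rewrite -mulrA -mulrDr; congr (_ * _); rewrite /threshold_value.
case: ltnP => kx; first by rewrite subSS.
have -> : k = x by lia.
by rewrite big_geq// subnn expr0 mul1r add0r.
Qed.

Lemma threshold_value_gt v1 x : (k < x)%N -> threshold_value v1 x = tail_value v1 x.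
Proof. by rewrite /threshold_value ltnNge => /negbTE ->. Qed.

Lemma threshold_value1 v1 : threshold_value v1 1 =
  \sum_(1 <= l < k.+1) beta ^+ (l - 1) * (c l - eta) + beta ^+ k * tail_value v1 k.+1.
Proof.
rewrite /threshold_value; case: ltnP => k0; first by rewrite subn1.
have -> : k = 0%N by lia.
by rewrite big_geq// expr0 mul1r add0r.
Qed.

Lemma stationary_threshold j : stationary (@threshold R j).
Proof. by move=> i _; rewrite /threshold; case: ltnP => _ /=; rewrite ?lexx ?ler01. Qed.

Hypotheses (hlambda : 0 < lambda <= 1) (hmu : 0 < mu <= 1).
Hypothesis hbeta : 0 < beta <= 1.
Hypotheses (hc : nonneg_nondecreasing c)
  (hs : tail_summable ((1 - lambda * mu) * beta) c).

Lemma success_prob_bounds : 0 < p <= 1.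
Proof.
have /andP[l0 l1] := hlambda; have /andP[m0 m1] := hmu.
by rewrite mulr_gt0//= mulr_ile1// ltW.
Qed.

Lemma discounted_failure_bounds : 0 <= q * beta < 1.
Proof. have := success_prob_bounds; have := hbeta; nra. Qed.

Lemma threshold_value_after v1 x : (k < x)%N ->
  threshold_value v1 x = c x + lambda * nu - eta +
    beta * (q * threshold_value v1 x.+1 + p * v1).
Proof.
move=> kx; have x0 : (0 < x)%N by lia.
rewrite !threshold_value_gt ?(ltnW kx)//; last by lia.
have /andP[qb0 qb1] := discounted_failure_bounds.
have qbn : 1 - (1 - lambda * mu) * beta != 0 by rewrite gt_eqF// subr_gt0.
by rewrite /tail_value (tail_sumE qb0 hc hs x0); field.
Qed.

Lemma arrival_mean_threshold v1 x : (0 < x)%N ->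
  arrival_mean lambda (threshold_state_value v1) x = threshold_value v1 x.
Proof.
move=> x0; rewrite /arrival_mean /threshold_state_value/=.
case: ltnP => kx /=; first by rewrite [RHS]threshold_value_after//; ring.
by rewrite [RHS]threshold_value_before//; ring.
Qed.

(** The self-consistency condition at AoI 1 determines eta when beta = 1 and v1 = 0, and determines
    v1 when beta < 1 and eta = 0. *)
Lemma threshold_state_valueE v1 b i : threshold_value v1 1 = v1 -> (0 < i)%N ->
  threshold_state_value v1 (b, i) = act_mean (threshold k) (b, i) (fun a =>
    stage_cost (b, i) a - eta +
    beta * trans_mean lambda mu (b, i) a (threshold_state_value v1)).
Proof.
move=> W1 i0; rewrite /act_mean /trans_mean !arrival_mean_threshold// W1.
rewrite /threshold_state_value /stage_cost /threshold/=.
by case: b => /=; [case: ltnP => _ /=|]; ring.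
Qed.

(** Above k a value is a nonnegative tail sum plus a constant, and up to k there are finitely many
    values. A lower bound is what [average_supersolution] asks for. *)
Lemma threshold_state_value_lb v1 : exists M, forall b i, (0 < i)%N ->
  - M <= threshold_state_value v1 (b, i).
Proof.
have /andP[qb0 qb1] := discounted_failure_bounds.
have /andP[m0 m1] := hmu; have /andP[b0 b1] := hbeta.
pose K := `|(lambda * nu - eta + p * beta * v1) / (1 - q * beta)|.
pose D := K + \sum_(0 <= l < k.+1) `|threshold_value v1 l|.
have WD x : (0 < x)%N -> - D <= threshold_value v1 x.
  move=> x0; rewrite /D; case: (leqP x k) => xk.
    have : `|threshold_value v1 x| <= \sum_(0 <= l < k.+1) `|threshold_value v1 l|.
      rewrite (big_rem x) ?mem_index_iota ?ltnS//= lerDl.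
      by apply: sumr_ge0.
    have K0 : 0 <= K by exact: normr_ge0.
    have := ler_norm (- threshold_value v1 x); rewrite normrN; lra.
  have : 0 <= \sum_(0 <= l < k.+1) `|threshold_value v1 l| by apply: sumr_ge0.
  rewrite threshold_value_gt// /tail_value.
  have := tail_sum_ge0 qb0 hc hs x0.
  have := ler_norm (- ((lambda * nu - eta + p * beta * v1) / (1 - q * beta))).
  rewrite normrN -/K; lra.
have D0 : 0 <= D.
  by rewrite addr_ge0 ?normr_ge0 ?sumr_ge0.
exists (`|eta| + `|nu| + mu * `|v1| + D) => b i i0; rewrite /threshold_state_value/=.
have := hc.1 _ i0; have := WD i.+1 isT.
have := ler_norm eta; have := ler_norm (- nu); have := ler_norm (- v1).
have := normr_ge0 nu; have := normr_ge0 v1.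
rewrite !normrN; set W := threshold_value _ _.
move=> v0 n0 vn nn en WD1 ci.
have mv0 : 0 <= mu * `|v1| by rewrite mulr_ge0// ltW.
case: ifP => _.
  have a0 : 0 <= beta * (1 - mu) by rewrite mulr_ge0 ?subr_ge0// ltW.
  have a1 : beta * (1 - mu) <= 1 by nra.
  have bW : - D <= beta * ((1 - mu) * W).
    by rewrite mulrA; move: a0 a1 WD1 D0; clear; set a := beta * _; nra.
  have bv : - `|v1| <= beta * v1 by nra.
  have : mu * - `|v1| <= mu * (beta * v1) by rewrite ler_wpM2l// ltW.
  rewrite (mulrDr beta) (mulrCA beta mu); lra.
have : - D <= beta * W by nra.
lra.
Qed.

End ThresholdValue.

(** * Optimality under the average criterion *)

Section RelativeValues.
Context {R : realType}.
Variables (lambda mu : R) (c : nat -> R) (nu eta : R) (u : nat -> R).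
Hypotheses (hlambda : 0 < lambda <= 1) (hmu : 0 < mu <= 1).
Hypothesis u1 : u 1 = 0.
Hypothesis u_eq : forall x, (0 < x)%N ->
  u x = c x - eta + u x.+1 + lambda * Num.min 0 (nu - mu * u x.+1).

(** State values recovered from their mean [u] over the packet indicator: since u_1 = 0, attempting
    instead of idling adds nu - mu u_(i+1). *)
Definition relative_state_value (s : state) : R :=
  c s.2 - eta + u s.2.+1 + (if s.1 then Num.min 0 (nu - mu * u s.2.+1) else 0).

Local Notation h := relative_state_value.

Lemma arrival_mean_relative x : (0 < x)%N -> arrival_mean lambda h x = u x.
Proof.
by move=> x0; rewrite /arrival_mean /relative_state_value/= (u_eq x0); ring.
Qed.

Lemma q_value_relative b i a : (0 < i)%N ->
  q_value lambda mu c nu eta h (b, i) a =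
  c i + nu * a%:R - eta + u i.+1 - (if b && a then mu * u i.+1 else 0).
Proof.
move=> i0; rewrite /q_value /trans_mean !arrival_mean_relative// u1/=.
by case: ifP => _; ring.
Qed.

Lemma relative_optimality_equations :
  average_optimality_equations lambda mu c nu eta h.
Proof.
move=> i i0; rewrite !q_value_relative// /relative_state_value/=; split; first ring.
rewrite [in RHS]/Num.min /Num.min; case: ifP; case: ifP => //; lra.
Qed.

Lemma relative_le_act_mean tau b i : stationary tau -> (0 < i)%N ->
  h (b, i) <= act_mean tau (b, i) (q_value lambda mu c nu eta h (b, i)).
Proof.
move=> st i0; rewrite /act_mean !q_value_relative// /relative_state_value/=.
case: b => /=; last lra.
have /andP[t0 t1] := st _ i0; rewrite /Num.min; case: ifP => hlt; nra.
Qed.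

Lemma relative_eq_act_mean sigma b i : (0 < i)%N ->
  (forall x, (0 < x)%N -> sigma x = 1 /\ nu <= mu * u x.+1 \/
                          sigma x = 0 /\ mu * u x.+1 <= nu) ->
  h (b, i) = act_mean sigma (b, i) (q_value lambda mu c nu eta h (b, i)).
Proof.
move=> i0 hs; rewrite /act_mean !q_value_relative// /relative_state_value/=.
case: b => /=; last ring.
by case: (hs _ i0) => -[-> ?]; rewrite /Num.min; case: ifP => hlt; lra.
Qed.

(** Two cost sequences occur because [u] has to be bounded above: [c] is the truncated cost for
    which it is, while [c'] is the cost in the objective. *)
Lemma relative_lower_bound (c' : nat -> R) M tau b i : 0 <= nu ->
  (forall x, (0 < x)%N -> c x <= c' x) -> (forall x, (0 < x)%N -> 0 <= c' x) ->
  (forall x, (0 < x)%N -> c x <= M) -> (forall x, (0 < x)%N -> u x <= M) ->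
  stationary tau -> (0 < i)%N ->
  (eta%:E <= avg_objective lambda mu c' nu tau (b, i))%E.
Proof.
move=> nu0 cc' c'0 cM uM st i0.
have hM b' i' : (0 < i')%N -> h (b', i') <= M - eta + M.
  move=> i'0; rewrite /relative_state_value/=.
  have := cM _ i'0; have := uM i'.+1 isT.
  by case: b'; rewrite /Num.min; [case: ifP => hlt|]; lra.
apply: (@long_run_average_comb_ge _ _ _ hlambda hmu tau _ _ nu b i eta
  (M - eta + M - h (b, i))) => //.
- by move=> b' i' a i'0; exact: c'0.
- exact: avg_work_fin_num.
apply: average_subsolution => // b' i' i'0.
apply: le_trans (relative_le_act_mean b' st i'0) _.
apply: act_mean_le => // a; rewrite /q_value /aoi_cost /attempt/=.
by rewrite lerD2r lerD2r lerD2r cc'.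
Qed.

End RelativeValues.

(** * Gains, indices and relative values of threshold policies *)

Section ThresholdAverage.
Context {R : realType}.
Variables (lambda mu : R).
Hypotheses (hlambda : 0 < lambda <= 1) (hmu : 0 < mu <= 1).
Implicit Types (c : nat -> R) (k j x : nat) (nu : R).

Local Notation p := (lambda * mu).
Local Notation q := (1 - lambda * mu).
Local Notation S := (tail_sum q).

Definition cost_sum c k : R := \sum_(1 <= l < k.+1) c l.

(* Expected cost of a cycle between resets, over its expected length k + 1 / p. *)
Definition threshold_gain c k nu : R :=
  p * (cost_sum c k + S c k.+1 + nu / mu) / (1 + k%:R * p).

Definition mp_index c j : R := mu * (j%:R * p * S c j.+1 - cost_sum c j).

Definition relative_value c k nu : nat -> R :=
  threshold_value lambda mu 1 c k nu (threshold_gain c k nu) 0.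

Let p0 : 0 < p. Proof. by case/andP: (success_prob_bounds hlambda hmu). Qed.
Let p1 : p <= 1. Proof. by case/andP: (success_prob_bounds hlambda hmu). Qed.
Let l0 : 0 < lambda. Proof. by case/andP: hlambda. Qed.
Let m0 : 0 < mu. Proof. by case/andP: hmu. Qed.
Let q0 : 0 <= q. Proof. by rewrite subr_ge0. Qed.
Let ln0 : lambda != 0. Proof. by rewrite gt_eqF. Qed.
Let mn0 : mu != 0. Proof. by rewrite gt_eqF. Qed.
Let b01 : 0 < (1 : R) <= 1. Proof. by rewrite ltr01 lexx. Qed.
Let kp0 k : 0 < 1 + k%:R * p.
Proof. by rewrite ltr_wpDr// mulr_ge0 ?ler0n// ltW. Qed.

Section Fixed.
Variable c : nat -> R.
Hypotheses (hc : nonneg_nondecreasing c) (hs : tail_summable q c).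

Let hs1 : tail_summable (q * 1) c. Proof. by rewrite mulr1. Qed.

Lemma cost_sumS k : cost_sum c k.+1 = cost_sum c k + c k.+1.
Proof. by rewrite /cost_sum big_nat_recr. Qed.

Lemma cost_sum0 : cost_sum c 0 = 0. Proof. by rewrite /cost_sum big_geq. Qed.

Lemma mp_index0 : mp_index c 0 = 0.
Proof. by rewrite /mp_index cost_sum0 !mul0r subr0 mulr0. Qed.

(** The increment is mu (1 + k p) (p S_(k+2) - c_(k+1)), and p S_(k+2) >= c_(k+2) >= c_(k+1). *)
Lemma mp_index_leS k : mp_index c k <= mp_index c k.+1.
Proof.
rewrite /mp_index cost_sumS ler_pM2l// (tail_sumE q0 hc hs (ltn0Sn k)) -natr1.
have := tail_sum_ge q0 hc hs (ltn0Sn k.+1).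
have := hc.2 k.+1 k.+2 isT (leqnSn _); set s := tail_sum _ _ _.
have : 0 <= k%:R * p by rewrite mulr_ge0 ?ler0n// ltW.
set K := k%:R; rewrite (mulrDl K) (mulrDl _ _ s) mul1r => Kp0 cc cs.
nra.
Qed.

Lemma mp_index_homo k j : (k <= j)%N -> mp_index c k <= mp_index c j.
Proof. by apply: (homo_leq (@lexx _ R) (@le_trans _ R)); exact: mp_index_leS. Qed.

Lemma relative_value_gt k nu x : (k < x)%N ->
  relative_value c k nu x = S c x + nu / mu - threshold_gain c k nu / p.
Proof.
move=> kx; rewrite /relative_value threshold_value_gt// /tail_value !mulr1.
by rewrite mulr0 addr0 subKr; field; rewrite mn0 ln0.
Qed.

(** This normalization is what determines [threshold_gain]. *)
Lemma relative_value1 k nu : relative_value c k nu 1 = 0.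
Proof.
rewrite /relative_value threshold_value1//; under eq_bigr => l _ do rewrite expr1n mul1r.
rewrite sumrB sumr_const_nat subn1 -/(cost_sum c k) expr1n mul1r /tail_value.
rewrite !mulr1 mulr0 addr0 subKr /threshold_gain -mulr_natl.
by field; rewrite mn0 ln0 gt_eqF//.
Qed.

(** On the left stands the advantage of attempting over idling in (1, k), the last state in which
    the k-policy idles. The next lemma treats (1, k + 1), the first in which it attempts. *)
Lemma relative_value_threshold k nu :
  mu * relative_value c k nu k.+1 - nu = (mp_index c k - nu) / (1 + k%:R * p).
Proof.
rewrite relative_value_gt// /mp_index /threshold_gain.
by field; rewrite mn0 ln0 gt_eqF//.
Qed.

Lemma relative_value_thresholdS k nu :
  mu * relative_value c k nu k.+2 - nu = (mp_index c k.+1 - nu) / (1 + k%:R * p).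
Proof.
rewrite relative_value_gt// /mp_index /threshold_gain cost_sumS -natr1.
rewrite (tail_sumE q0 hc hs (ltn0Sn k)).
by field; rewrite mn0 ln0 gt_eqF//.
Qed.

(** m_k <= nu means C_k + nu / mu >= k p S_(k+1), so the gain is at least p S_(k+1) >= c_(k+1) >=
    c_x. *)
Lemma cost_le_threshold_gain k nu x : (0 < x <= k)%N -> mp_index c k <= nu ->
  c x <= threshold_gain c k nu.
Proof.
move=> /andP[x0 xk] knu.
have ck : c x <= c k.+1 by apply: hc.2 => //; exact: leqW.
apply: (le_trans ck); rewrite /threshold_gain ler_pdivlMr//.
have : p * S c k.+1 >= c k.+1 by have := tail_sum_ge q0 hc hs (ltn0Sn k); rewrite subKr.
have : k%:R * p * S c k.+1 - cost_sum c k <= nu / mu.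
  by rewrite ler_pdivlMr// mulrC.
set s := tail_sum _ _ _; set C := cost_sum _ _; set K := k%:R => Hm Hc.
have K0 : 0 <= K * p by rewrite mulr_ge0 ?ler0n// ltW.
have H1 : p * (s * (1 + K * p)) <= p * (C + s + nu / mu).
  by rewrite ler_pM2l//; lra.
have H2 : c k.+1 * (1 + K * p) <= p * s * (1 + K * p) by rewrite ler_wpM2r//; lra.
lra.
Qed.

(** While idling, u_(x+1) - u_x = eta - c_x, which is nonnegative by [cost_le_threshold_gain]; the
    induction descends from k + 1. *)
Lemma relative_value_le k nu x : (0 < x <= k)%N -> mp_index c k <= nu ->
  relative_value c k nu x.+1 <= relative_value c k nu k.+1.
Proof.
move=> /andP[x0 xk] knu; rewrite -(subKn xk).
have: (k - x < k)%N by rewrite ltn_subrL x0 (leq_trans x0 xk).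
elim: (k - x)%N => [|n IH] nk; first by rewrite subn0.
apply: le_trans (IH (ltnW nk)); rewrite subnSK ?(ltnW nk)//.
rewrite {1}/relative_value threshold_value_before ?leq_subr//.
rewrite -/(relative_value c k nu) mul1r gerDr subr_le0.
by apply: cost_le_threshold_gain => //; rewrite subn_gt0 (ltnW nk) leq_subr.
Qed.

Lemma relative_value_ge k nu x : (k < x)%N ->
  relative_value c k nu k.+2 <= relative_value c k nu x.+1.
Proof.
move=> kx; rewrite !relative_value_gt ?(leqW kx)//.
rewrite lerD2r lerD2r; exact: tail_sum_homo.
Qed.

(** By [relative_value_le] and [relative_value_ge] the comparisons in (1, k) and (1, k + 1) decide
    all others. For k = 0 no state lies below the threshold, so m_k <= nu is asked only for k > 0;
    this admits negative charges. *)
Lemma threshold_action k nu x : (0 < x)%N -> (0 < k)%N ==> (mp_index c k <= nu) ->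
  nu <= mp_index c k.+1 ->
  if (k < x)%N then nu <= mu * relative_value c k nu x.+1
  else mu * relative_value c k nu x.+1 <= nu.
Proof.
move=> x0 knu nuk; case: ltnP => kx.
  apply: (@le_trans _ _ (mu * relative_value c k nu k.+2)).
    rewrite -subr_ge0 relative_value_thresholdS divr_ge0 ?subr_ge0//.
    exact: ltW (kp0 k).
  by rewrite ler_pM2l// relative_value_ge.
have k0 : (0 < k)%N := leq_trans x0 kx.
move: knu; rewrite k0/= => knu.
apply: (@le_trans _ _ (mu * relative_value c k nu k.+1)).
  by rewrite ler_pM2l// relative_value_le ?x0.
rewrite -subr_le0 relative_value_threshold mulr_le0_ge0 ?subr_le0// invr_ge0.
exact: ltW (kp0 k).
Qed.

Lemma relative_value_eq k nu x : (0 < x)%N -> (0 < k)%N ==> (mp_index c k <= nu) ->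
  nu <= mp_index c k.+1 ->
  relative_value c k nu x = c x - threshold_gain c k nu + relative_value c k nu x.+1 +
    lambda * Num.min 0 (nu - mu * relative_value c k nu x.+1).
Proof.
move=> x0 knu nuk; have := threshold_action x0 knu nuk.
case: ltnP => kx act; rewrite {1}/relative_value.
  rewrite threshold_value_after// -/(relative_value c k nu).
  by rewrite (min_r _) ?subr_le0//; ring.
rewrite threshold_value_before// -/(relative_value c k nu) mul1r.
by rewrite (min_l _) ?subr_ge0// mulr0 addr0.
Qed.

Lemma threshold_gain_lower k nu tau b i (c' : nat -> R) M : 0 <= nu ->
  (forall x, (0 < x)%N -> c x <= c' x) -> (forall x, (0 < x)%N -> c x <= M) ->
  (forall x, (0 < x)%N -> S c x <= M) ->
  mp_index c k <= nu <= mp_index c k.+1 -> stationary tau -> (0 < i)%N ->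
  ((threshold_gain c k nu)%:E <= avg_objective lambda mu c' nu tau (b, i))%E.
Proof.
move=> nu0 cc' cM sM /andP[knu nuk] st i0.
(* The second entry bounds the relative values above the threshold; nu / mu bounds those up to it,
   where idling is preferred or u_1 = 0. *)
pose M' := Num.max M (Num.max (M + nu / mu - threshold_gain c k nu / p) (nu / mu)).
have MM' : M <= M' by rewrite le_max lexx.
apply: (@relative_lower_bound _ _ _ c nu _ (relative_value c k nu) hlambda hmu
  (relative_value1 k nu) _ c' M') => //.
- by move=> x x0; apply: relative_value_eq; rewrite ?knu ?implybT.
- by move=> x x0; apply: le_trans (cc' _ x0); exact: hc.1.
- by move=> x x0; apply: le_trans MM'; exact: cM.
move=> [//|x] _; case: (ltnP k x.+1) => kx.
  rewrite /M' !le_max; apply/orP; right; apply/orP; left.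
  by rewrite relative_value_gt// lerD2r lerD2r sM.
rewrite /M' !le_max; apply/orP; right; apply/orP; right.
case: x kx => [|x] kx.
  by rewrite relative_value1 divr_ge0// ltW.
have := @threshold_action k nu x.+1 isT; rewrite knu implybT => /(_ isT nuk).
by rewrite ltnNge (ltnW kx)/= ler_pdivlMr// mulrC.
Qed.

End Fixed.
End ThresholdAverage.

(** * Canonical policies and uniqueness of relative values *)

Section Canonical.
Context {R : realType}.
Variables (lambda mu : R) (c : nat -> R) (nu eta : R) (u : nat -> R).
Hypotheses (hlambda : 0 < lambda <= 1) (hmu : 0 < mu <= 1).
Hypothesis u1 : u 1 = 0.
Hypothesis u_eq : forall x, (0 < x)%N ->
  u x = c x - eta + u x.+1 + lambda * Num.min 0 (nu - mu * u x.+1).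

Lemma relative_canonical sigma : stationary sigma ->
  (forall x, (0 < x)%N -> sigma x = 1 /\ nu <= mu * u x.+1 \/
                          sigma x = 0 /\ mu * u x.+1 <= nu) ->
  (forall tau, stationary tau -> forall b i, (0 < i)%N ->
    (eta%:E <= avg_objective lambda mu c nu tau (b, i))%E) ->
  (forall b i, (0 < i)%N -> (avg_objective lambda mu c nu sigma (b, i) <= eta%:E)%E) ->
  canonical_optimal lambda mu c nu sigma /\
  forall b i, (0 < i)%N -> avg_objective lambda mu c nu sigma (b, i) = eta%:E.
Proof.
move=> st act lower upper.
have objE b i : (0 < i)%N -> avg_objective lambda mu c nu sigma (b, i) = eta%:E.
  by move=> i0; apply/eqP; rewrite eq_le upper// lower.
split=> //; split.
  by split=> // tau stt b i i0; rewrite objE// lower.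
exists eta, (relative_state_value mu c nu eta u); split => //.
  exact: relative_optimality_equations.
by move=> b i i0; apply: relative_eq_act_mean.
Qed.

(** u_x determines F(u_(x+1)), where F(y) = y + lambda min(0, nu - mu y) has slope 1 for mu y <= nu
    and slope q beyond. A value F(y) with mu y < nu has a single preimage even when q = 0. *)
Lemma relative_value_unique_below (u' : nat -> R) n : u' 1 = 0 ->
  (forall x, (0 < x)%N ->
    u' x = c x - eta + u' x.+1 + lambda * Num.min 0 (nu - mu * u' x.+1)) ->
  (forall x, (0 < x <= n)%N -> mu * u x.+1 < nu) ->
  forall x, (x <= n)%N -> u' x.+1 = u x.+1.
Proof.
move=> u'1 u'_eq un; elim=> [_|x IH xn]; first by rewrite u'1 u1.
have := IH (ltnW xn); rewrite (u_eq (ltn0Sn x)) (u'_eq _ (ltn0Sn x)).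
have /andP[l0 l1] := hlambda; have /andP[m0 m1] := hmu.
have un' := un x.+1 xn.
rewrite (min_l (y := nu - mu * u _)) ?subr_ge0 ?ltW// minEle.
case: ifP => [_|/negbT]; first by move=> ?; lra.
rewrite -ltNge => h1 h2; exfalso.
have h3 : u' x.+2 + lambda * (nu - mu * u' x.+2) = u x.+2 by lra.
have h4 : (mu * u' x.+2 - nu) * (1 - lambda * mu) < 0.
  have -> : (mu * u' x.+2 - nu) * (1 - lambda * mu) = mu * u x.+2 - nu.
    by rewrite -h3; ring.
  by rewrite subr_lt0.
have : 0 <= (mu * u' x.+2 - nu) * (1 - lambda * mu).
  have /andP[_ p1] := success_prob_bounds hlambda hmu.
  by apply: mulr_ge0; lra.
lra.
Qed.

(** For q > 0 the map y + lambda min(0, nu - mu y) is injective, so forward recursion never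
    stops. *)
Lemma relative_value_unique (u' : nat -> R) : lambda * mu < 1 -> u' 1 = 0 ->
  (forall x, (0 < x)%N ->
    u' x = c x - eta + u' x.+1 + lambda * Num.min 0 (nu - mu * u' x.+1)) ->
  forall x, u' x.+1 = u x.+1.
Proof.
move=> p1 u'1 u'_eq; elim=> [|x IH]; first by rewrite u'1 u1.
have := IH; rewrite (u_eq (ltn0Sn x)) (u'_eq _ (ltn0Sn x)).
have /andP[l0 l1] := hlambda; have /andP[m0 m1] := hmu.
set y := u' x.+2; set z := u x.+2 => /eqP; rewrite -!addrA !(inj_eq (addrI _)) => /eqP.
have p0 : 0 < lambda * mu by rewrite mulr_gt0.
rewrite !minEle; case: ifP => [h1|/negbT]; case: ifP => [h2|/negbT]; rewrite -?ltNge.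
- by rewrite mulr0 !addr0.
- by move=> h2; nra.
- by move=> h1; nra.
- move=> h2 h1 h; have : (y - z) * (1 - lambda * mu) = 0 by lra.
  by move/eqP; rewrite mulf_eq0 => /orP[]/eqP; lra.
Qed.

End Canonical.

(** * Optimality of threshold policies *)

Section Objectives.
Context {R : realType}.
Variables (lambda mu : R).
Hypotheses (hlambda : 0 < lambda <= 1) (hmu : 0 < mu <= 1).

Local Notation p := (lambda * mu).
Local Notation q := (1 - lambda * mu).

Let p0 : 0 < p. Proof. by case/andP: (success_prob_bounds hlambda hmu). Qed.
Let p1 : p <= 1. Proof. by case/andP: (success_prob_bounds hlambda hmu). Qed.
Let l0 : 0 < lambda. Proof. by case/andP: hlambda. Qed.
Let m0 : 0 < mu. Proof. by case/andP: hmu. Qed.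
Let q0 : 0 <= q. Proof. by rewrite subr_ge0. Qed.
Let mn0 : mu != 0. Proof. by rewrite gt_eqF. Qed.
Let b01 : 0 < (1 : R) <= 1. Proof. by rewrite ltr01 lexx. Qed.
Let kp0 k : 0 < 1 + k%:R * p.
Proof. by rewrite ltr_wpDr// mulr_ge0 ?ler0n// ltW. Qed.

Lemma lee_npmul2l_fin (a : R) (x y : \bar R) : a <= 0 -> (x <= y)%E ->
  (a%:E * y <= a%:E * x)%E.
Proof.
move=> a0 xy; rewrite -leeN2 -!mulNe -EFinN.
by apply: lee_wpmul2l; rewrite ?lee_fin ?oppr_ge0.
Qed.

(** The expected number 1 / mu of attempts in a cycle, over the expected cycle length k + 1 / p. *)
Definition threshold_work k : R := lambda / (1 + k%:R * p).

Lemma threshold_work_ge0 k : 0 <= threshold_work k.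
Proof. by rewrite divr_ge0// ltW. Qed.

Lemma threshold_gainE c k nu :
  threshold_gain lambda mu c k nu = threshold_gain lambda mu c k 0 + nu * threshold_work k.
Proof. by rewrite /threshold_gain /threshold_work; field; rewrite mn0 gt_eqF. Qed.

(** Applied once with charge 0 and once with zero costs and charge 1, this bounds cost and work
    separately, as an objective that adds two upper limits requires. *)
Lemma long_run_average_threshold_le c k nu b i :
  nonneg_nondecreasing c -> tail_summable q c -> (0 < i)%N ->
  (long_run_average lambda mu (stage_cost c nu) (threshold k) (b, i) <=
    (threshold_gain lambda mu c k nu)%:E)%E.
Proof.
move=> hc hs i0; have hs1 : tail_summable (q * 1) c by rewrite mulr1.
pose v := threshold_state_value lambda mu 1 c k nu (threshold_gain lambda mu c k nu) 0.
have [M vM] := threshold_state_value_lb k nu (threshold_gain lambda mu c k nu)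
  hlambda hmu b01 hc hs1 0.
apply: long_run_average_le.
apply: (@average_supersolution _ _ _ hlambda hmu _ _ v _ M) => //.
  by apply: stationary_threshold.
move=> b' i' i'0.
rewrite [leRHS](threshold_state_valueE hlambda hmu b01 hc hs1)//.
  by rewrite /act_mean !mul1r.
exact: (relative_value1 hlambda hmu).
Qed.

Lemma avg_cost_threshold_le c k b i :
  nonneg_nondecreasing c -> tail_summable q c -> (0 < i)%N ->
  (avg_cost lambda mu c (threshold k) (b, i) <= (threshold_gain lambda mu c k 0)%:E)%E.
Proof.
move=> hc hs i0; have := long_run_average_threshold_le k 0 b hc hs i0.
congr (Order.le (long_run_average _ _ _ _ _) _).
by apply/funext => s; apply/funext => a; rewrite /stage_cost mul0r addr0.
Qed.

Lemma zero_nonneg_nondecreasing : nonneg_nondecreasing (fun=> 0 : R).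
Proof. by split. Qed.

Lemma tail_summable_zero r : tail_summable r (fun=> 0 : R).
Proof.
move=> x _; exists 0 => N.
by rewrite /partial_sum big1// => n _; rewrite mulr0.
Qed.

Lemma tail_sum_zero r x : tail_sum r (fun=> 0 : R) x = 0.
Proof.
rewrite /tail_sum (_ : partial_sum _ _ _ = fun=> 0) ?lim_cst//.
by apply/funext => N; rewrite /partial_sum big1// => n _; rewrite mulr0.
Qed.

Lemma avg_work_threshold_le k b i : (0 < i)%N ->
  (avg_work lambda mu (threshold k) (b, i) <= (threshold_work k)%:E)%E.
Proof.
move=> i0; have := long_run_average_threshold_le k 1 b zero_nonneg_nondecreasing
  (@tail_summable_zero q) i0.
rewrite (_ : threshold_gain _ _ _ _ _ = threshold_work k); last first.
  rewrite /threshold_gain tail_sum_zero /cost_sum big1// /threshold_work.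
  by field; rewrite mn0 gt_eqF.
congr (Order.le (long_run_average _ _ _ _ _) _).
by apply/funext => s; apply/funext => a; rewrite /stage_cost mul1r add0r.
Qed.

Lemma avg_work_threshold0_ge b i : (0 < i)%N ->
  (lambda%:E <= avg_work lambda mu (threshold 0) (b, i))%E.
Proof.
move=> i0; apply: long_run_average_ge.
apply: (@average_subsolution _ _ _ hlambda hmu _ _ (fun s => s.1%:R) lambda 1) => //.
- exact: stationary_threshold.
- by move=> b' i' _; rewrite lern1 leq_b1.
move=> b' i' i'0; rewrite /act_mean /attempt /trans_mean /arrival_mean /threshold/= i'0.
by case: b' => /=; lra.
Qed.

(** For nu < 0 a lower bound on the work is needed; it is available for k = 0, the only threshold
    used with such charges. *)
Lemma avg_objective_threshold_le c k nu b i :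
  nonneg_nondecreasing c -> tail_summable q c -> (0 < i)%N -> (0 <= nu) || (k == 0%N) ->
  (avg_objective lambda mu c nu (threshold k) (b, i) <=
    (threshold_gain lambda mu c k nu)%:E)%E.
Proof.
move=> hc hs i0 nuk; rewrite threshold_gainE EFinD (EFinM nu).
apply: leeD; first exact: avg_cost_threshold_le.
have [nu0|nu0] := leP 0 nu.
  by apply: lee_wpmul2l; rewrite ?lee_fin//; exact: avg_work_threshold_le.
move: nuk; rewrite leNgt nu0/= => /eqP ->.
rewrite /threshold_work mul0r addr0 divr1.
by rewrite lee_npmul2l_fin ?(ltW nu0)//; exact: avg_work_threshold0_ge.
Qed.

Section Fixed.
Variable c : nat -> R.
Hypotheses (hc : nonneg_nondecreasing c) (hs : tail_summable q c).

Local Notation m := (mp_index lambda mu c).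
Local Notation gain := (threshold_gain lambda mu c).
Local Notation obj := (avg_objective lambda mu c).

Lemma truncate_summable N : (0 < N)%N -> tail_summable q (truncate N c).
Proof.
move=> N0; have qq : 0 <= q <= q by rewrite q0/=.
exact: tail_summable_le qq hc (fun i => truncate_le hc N0) hs.
Qed.

Lemma truncate_cost_sum N k : (k <= N)%N -> cost_sum (truncate N c) k = cost_sum c k.
Proof.
move=> kN; apply: eq_big_nat => l /andP[_ lk]; rewrite /truncate (minn_idPl _)//.
by rewrite -ltnS (leq_trans lk).
Qed.

Lemma truncate_mp_index_cvg k :
  mp_index lambda mu (truncate N c) k @[N --> \oo] --> m k.
Proof.
have : mu * (k%:R * p * tail_sum q (truncate N c) k.+1 - cost_sum c k) @[N --> \oo] --> m k.
  apply: cvgMl_tmp; apply: cvgB; last exact: cvg_cst.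
  by apply: cvgMl_tmp; exact: tail_sum_truncate_cvg.
apply: cvg_trans; apply: near_eq_cvg; near=> N.
rewrite /mp_index truncate_cost_sum//; near: N; exact: nbhs_infty_ge.
Unshelve. all: by end_near. Qed.

Lemma truncate_gain_cvg k nu :
  threshold_gain lambda mu (truncate N c) k nu @[N --> \oo] --> gain k nu.
Proof.
have : p * (cost_sum c k + tail_sum q (truncate N c) k.+1 + nu / mu) / (1 + k%:R * p)
    @[N --> \oo] --> gain k nu.
  apply: cvgMr_tmp; apply: cvgMl_tmp; apply: cvgD; last exact: cvg_cst.
  by apply: cvgD; [exact: cvg_cst|exact: tail_sum_truncate_cvg].
apply: cvg_trans; apply: near_eq_cvg; near=> N.
rewrite /threshold_gain truncate_cost_sum//; near: N; exact: nbhs_infty_ge.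
Unshelve. all: by end_near. Qed.

Lemma truncate_mp_index_le N k : (0 < N)%N -> (k <= N)%N ->
  mp_index lambda mu (truncate N c) k <= m k.
Proof.
move=> N0 kN; rewrite /mp_index truncate_cost_sum// ler_pM2l// lerD2r.
apply: ler_wpM2l; first by rewrite mulr_ge0 ?ler0n// ltW.
have qq : 0 <= q <= q by rewrite q0/=.
apply: ler_tail_sum (qq) _ _ (fun i => truncate_le hc N0) _ _ => //.
exact: truncate_nonneg_nondecreasing.
Qed.

(* Truncating the costs makes the relative values bounded, as the verification
   argument for an arbitrary policy requires. *)
Lemma avg_objective_ge_of_truncate k nu tau b i : 0 <= nu -> m k <= nu ->
  (\forall N \near \oo, nu <= mp_index lambda mu (truncate N c) k.+1) ->
  stationary tau -> (0 < i)%N -> ((gain k nu)%:E <= obj nu tau (b, i))%E.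
Proof.
move=> nu0 knu nuk st i0; apply/lee_addgt0Pr => e e0; rewrite -leeBlDr//.
have /cvgrPdist_le/(_ _ e0) near_gain := truncate_gain_cvg (k := k) (nu := nu).
have [N [[Ngain Nnu] [N0 kN]]] := filter_ex (filterI (filterI near_gain nuk)
  (filterI (nbhs_infty_ge 1%N) (nbhs_infty_ge k))).
apply: (@le_trans _ _ (threshold_gain lambda mu (truncate N c) k nu)%:E).
  by rewrite -EFinB lee_fin; move: Ngain; rewrite ler_norml; lra.
have hcN := truncate_nonneg_nondecreasing hc N0.
have tr x : (0 < x)%N -> truncate N c x <= c N.
  by move=> x0; apply: hc.2; rewrite ?geq_minr// leq_min x0.
apply: (@threshold_gain_lower _ _ _ hlambda hmu _ hcN (truncate_summable N0)
  k nu tau b i c (Num.max (c N) (c N / (1 - q)))) => //.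
- by move=> x x0; case/andP: (truncate_le hc N0 x0).
- by move=> x x0; rewrite le_max tr.
- move=> x x0; rewrite le_max tail_sum_truncate_bound ?orbT//.
  by rewrite q0/= ltrBlDr ltrDl.
- by rewrite Nnu andbT (le_trans (truncate_mp_index_le N0 kN)).
Qed.

(** The truncated indices converge to m_(k+1), so strictness keeps nu below them for large N. *)
Lemma avg_objective_ge_lt k nu tau b i : 0 <= nu -> m k <= nu -> nu < m k.+1 ->
  stationary tau -> (0 < i)%N -> ((gain k nu)%:E <= obj nu tau (b, i))%E.
Proof.
move=> nu0 knu nuk; apply: avg_objective_ge_of_truncate => //.
have d0 : 0 < m k.+1 - nu by rewrite subr_gt0.
have /cvgrPdist_le/(_ _ d0) := @truncate_mp_index_cvg k.+1.
by apply: filterS => N; rewrite ler_norml; lra.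
Qed.

(** At nu = m_(k+1) the truncated indices may stay below nu, so the bound is taken at nu - d: the
    objective is nondecreasing in the charge and the gain is affine in it. *)
Lemma avg_objective_ge_gt k nu tau b i : 0 < nu -> m k < nu -> nu <= m k.+1 ->
  stationary tau -> (0 < i)%N -> ((gain k nu)%:E <= obj nu tau (b, i))%E.
Proof.
move=> nu0 knu nuk st i0; apply/lee_addgt0Pr => e e0; rewrite -leeBlDr//.
have mk0 : 0 <= m k by rewrite -(mp_index0 lambda mu c); exact: mp_index_homo.
(* The first entry keeps nu - d >= m_k; the second makes the loss d [threshold_work k] in the gain
   at most e. *)
pose d := Num.min (nu - m k) (e / (1 + threshold_work k)).
have w0 := threshold_work_ge0 k.
have d0 : 0 < d by rewrite lt_min subr_gt0 knu divr_gt0// ltr_wpDr.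
have dnu : d <= nu - m k by rewrite ge_min lexx.
have dw : d * (1 + threshold_work k) <= e.
  by rewrite -ler_pdivlMr ?ltr_wpDr// ge_min lexx orbT.
have := @avg_objective_ge_lt k (nu - d) tau b i _ _ _ st i0.
move=> /(_ _ _ _)/le_trans H; apply: (@le_trans _ _ (gain k (nu - d))%:E).
  rewrite -EFinB lee_fin threshold_gainE [leRHS]threshold_gainE.
  by rewrite mulrBl; lra.
apply: H; [lra|lra|lra|].
rewrite /avg_objective leeD2l// lee_wpmul2r ?avg_work_ge0// lee_fin; lra.
Qed.

(** The terms are bounded separately: the 0-policy has the least cost, by the case nu = 0, and the
    largest work, lambda. *)
Lemma avg_objective_ge_nonpos nu tau b i : nu <= 0 ->
  stationary tau -> (0 < i)%N -> ((gain 0 nu)%:E <= obj nu tau (b, i))%E.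
Proof.
move=> nu0 st i0; rewrite threshold_gainE EFinD (EFinM nu).
apply: leeD.
  have : ((gain 0 0)%:E <= obj 0 tau (b, i))%E.
    apply: avg_objective_ge_of_truncate => //; first by rewrite mp_index0.
    near=> N; have N0 : (0 < N)%N by near: N; exact: nbhs_infty_ge.
    rewrite -(mp_index0 lambda mu (truncate N c)); apply: mp_index_homo => //.
      exact: truncate_nonneg_nondecreasing.
    exact: truncate_summable.
  by rewrite /avg_objective mul0e adde0.
rewrite /threshold_work mul0r addr0 divr1.
by rewrite lee_npmul2l_fin//; exact: avg_work_le_lambda.
Unshelve. all: by end_near. Qed.

(* The k-policy is optimal for nu when m k <= nu <= m k.+1; the boundary cases
   that the verification argument leaves out are never needed. *)
Definition threshold_range k nu :=
  [\/ 0 <= nu /\ m k <= nu < m k.+1, 0 < nu /\ m k < nu <= m k.+1 |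
      nu <= 0 /\ k = 0%N].

Lemma mp_index_ge0 j : 0 <= m j.
Proof. by rewrite -(mp_index0 lambda mu c); apply: mp_index_homo. Qed.

Lemma threshold_range_le k nu : threshold_range k nu ->
  ((0 < k)%N ==> (m k <= nu)) && (nu <= m k.+1).
Proof.
case=> [[_ /andP[-> /ltW->]]|[_ /andP[/ltW-> ->]]|[nu0 ->]]; rewrite ?implybT//.
exact: le_trans (mp_index_ge0 1).
Qed.

Lemma threshold_canonical k nu : threshold_range k nu ->
  canonical_optimal lambda mu c nu (threshold k) /\
  forall b i, (0 < i)%N -> obj nu (threshold k) (b, i) = (gain k nu)%:E.
Proof.
move=> kr; have /andP[knu nuk] := threshold_range_le kr.
apply: (@relative_canonical _ _ _ c nu _ (relative_value lambda mu c k nu)).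
- exact: relative_value1.
- by move=> x x0; apply: relative_value_eq.
- exact: stationary_threshold.
- move=> x x0; have := threshold_action hlambda hmu hc hs x0 knu nuk.
  by rewrite /threshold; case: ifP => _ ?; [left|right].
- move=> tau st b i i0; case: kr => [[nu0 /andP[]]|[nu0 /andP[]]|[nu0 ->]].
  + by move=> ? ?; exact: avg_objective_ge_lt.
  + by move=> ? ?; exact: avg_objective_ge_gt.
  + exact: avg_objective_ge_nonpos.
move=> b i i0; apply: avg_objective_threshold_le => //.
by case: kr => [[-> _]|[/ltW-> _]|[_ ->]]; rewrite ?orbT.
Qed.

End Fixed.
End Objectives.

(** * Never attempting, and the Whittle index *)

Section Whittle.
Context {R : realType}.
Variables (lambda mu : R) (c : nat -> R).
Hypotheses (hlambda : 0 < lambda <= 1) (hmu : 0 < mu <= 1).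
Hypotheses (hc : nonneg_nondecreasing c) (hs : tail_summable (1 - lambda * mu) c).

Local Notation p := (lambda * mu).
Local Notation q := (1 - lambda * mu).
Local Notation m := (mp_index lambda mu c).
Local Notation gain := (threshold_gain lambda mu c).
Local Notation obj := (avg_objective lambda mu c).

Let p0 : 0 < p. Proof. by case/andP: (success_prob_bounds hlambda hmu). Qed.
Let p1 : p <= 1. Proof. by case/andP: (success_prob_bounds hlambda hmu). Qed.
Let m0 : 0 < mu. Proof. by case/andP: hmu. Qed.
Let q0 : 0 <= q. Proof. by rewrite subr_ge0. Qed.

(** A true supremum once [has_sup_cost] has bounded the costs; for unbounded costs [sup] returns a
    default value. *)
Definition cost_sup : R := sup [set c i.+1 | i in setT].

Definition never_value (x : nat) : R := \sum_(1 <= l < x) (cost_sup - c l).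

Lemma never_value1 : never_value 1 = 0.
Proof. by rewrite /never_value big_geq. Qed.

Lemma never_valueS x : (0 < x)%N ->
  never_value x.+1 = never_value x + (cost_sup - c x).
Proof. by move=> x0; rewrite /never_value big_nat_recr. Qed.

Lemma stationary_never : stationary (fun=> 0 : R).
Proof. by move=> i _; rewrite lexx ler01. Qed.

Lemma tail_sum_ge_next j : c j.+1 <= p * tail_sum q c j.+1.
Proof. by have := tail_sum_ge q0 hc hs (ltn0Sn j); rewrite subKr. Qed.

(** p S_(n+1) >= c_(n+1) gives the sum over all l <= n, whose terms are nonnegative and may be
    dropped beyond i. *)
Lemma mp_index_ge_sum i n : (i <= n)%N ->
  mu * \sum_(1 <= l < i.+1) (c n.+1 - c l) <= m n.
Proof.
move=> i_n; rewrite /mp_index ler_pM2l//.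
apply: (@le_trans _ _ (\sum_(1 <= l < n.+1) (c n.+1 - c l))).
  rewrite [leRHS](@big_cat_nat _ _ _ i.+1)//= lerDl big_nat_cond sumr_ge0//.
  move=> l /andP[/andP[il ln] _]; rewrite subr_ge0 hc.2//.
    exact: leq_trans il.
  exact: ltnW.
rewrite sumrB sumr_const_nat subn1/= -[X in X - _]mulr_natl -/(cost_sum c n).
by rewrite lerD2r -mulrA ler_wpM2l// tail_sum_ge_next.
Qed.

Section Never.
Variable nu : R.
Hypothesis m_le_nu : forall j, m j <= nu.

Let nu0 : 0 <= nu.
Proof. exact: le_trans (mp_index_ge0 hlambda hmu hc hs 0) (m_le_nu 0). Qed.

Lemma has_sup_cost : has_sup [set c i.+1 | i in setT].
Proof.
split; first by exists (c 1); exists 0%N.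
(* The first summand of [mp_index_ge_sum] alone yields mu (c_(n+1) - c_1) <= m_n <= nu. *)
exists (c 1 + nu / mu) => _ [i _ <-].
case: i => [|i]; first by rewrite lerDl divr_ge0// ltW.
have := le_trans (mp_index_ge_sum (ltn0Sn i)) (m_le_nu i.+1).
by rewrite big_nat1 -ler_pdivlMl// mulrC; lra.
Qed.

Lemma cost_le_sup i : (0 < i)%N -> c i <= cost_sup.
Proof.
case: i => // i _; apply: sup_upper_bound; first exact: has_sup_cost.
by exists i.
Qed.

Lemma never_value_le x : mu * never_value x.+1 <= nu.
Proof.
(* Replacing the supremum by a cost within d of it loses d in each of x terms; the additional 1
   keeps the divisor positive. *)
apply/ler_addgt0Pr => e e0; pose d := e / (mu * (1 + x%:R)).
have x0 : 0 < 1 + x%:R :> R by rewrite ltr_wpDr.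
have d0 : 0 < d by rewrite divr_gt0// mulr_gt0.
have [_ [n _ <-] cn] := sup_adherent d0 has_sup_cost.
have Hn := le_trans (mp_index_ge_sum (leq_maxl x n)) (m_le_nu (maxn x n)).
apply: (@le_trans _ _ (mu * \sum_(1 <= l < x.+1) (c (maxn x n).+1 - c l) + e)); last first.
  by rewrite lerD2r.
have -> : e = mu * (d + x%:R * d).
  rewrite /d; field; rewrite gt_eqF ?gt_eqF//.
rewrite -mulrDr ler_pM2l//.
have -> : x%:R * d = \sum_(1 <= l < x.+1) d by rewrite sumr_const_nat subn1 mulr_natl.
rewrite addrCA -big_split/= -[leLHS]add0r lerD ?(ltW d0)//.
apply: ler_sum => l _.
have : c n.+1 <= c (maxn x n).+1 by apply: hc.2; rewrite // ltnS leq_maxr.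
by move: cn; rewrite -/cost_sup; lra.
Qed.

(** Equality at x would, by [never_value_le] at x + 1, give sup c <= c_(x+1) <= p S_(x+1), and then
    m_x >= nu. *)
Lemma never_value_lt x : (forall j, (0 < j)%N -> m j < nu) ->
  (0 < x)%N -> mu * never_value x.+1 < nu.
Proof.
move=> m_lt x0; rewrite lt_neqAle never_value_le andbT; apply/eqP => eqnu.
have := m_lt x x0; apply/negP; rewrite -leNgt -eqnu /mp_index ler_pM2l//.
rewrite /never_value sumrB sumr_const_nat subn1/= -[X in X - _]mulr_natl.
rewrite -/(cost_sum c x) lerD2r -mulrA ler_wpM2l//.
apply: le_trans (tail_sum_ge_next x).
have := never_value_le x.+1; rewrite never_valueS// mulrDr eqnu.
by rewrite gerDl pmulr_rle0// subr_le0.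
Qed.

Lemma never_value_eq x : (0 < x)%N ->
  never_value x = c x - cost_sup + never_value x.+1 +
    lambda * Num.min 0 (nu - mu * never_value x.+1).
Proof.
move=> x0; rewrite min_l ?subr_ge0 ?never_value_le// mulr0 addr0 never_valueS//; ring.
Qed.

Lemma never_objective_le b i : (0 < i)%N ->
  (obj nu (fun=> 0%R) (b, i) <= cost_sup%:E)%E.
Proof.
move=> i0; rewrite -[leRHS]adde0; apply: leeD.
  apply: long_run_average_le.
  apply: (@average_supersolution _ _ _ hlambda hmu _ _ (fun=> 0) cost_sup 0 b i) => //.
  - exact: stationary_never.
  move=> b' i' i'0; rewrite /act_mean /aoi_cost /trans_mean /arrival_mean/=.
  by have := cost_le_sup i'0; case: b' => /=; lra.
rewrite mule_ge0_le0 ?lee_fin//; apply: long_run_average_le.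
apply: (@average_supersolution _ _ _ hlambda hmu _ _ (fun=> 0) 0 0 b i) => //.
- exact: stationary_never.
by move=> b' i' i'0; rewrite /act_mean /attempt /trans_mean /arrival_mean/=; case: b' => /=; lra.
Qed.

Lemma never_canonical : canonical_optimal lambda mu c nu (fun=> 0) /\
  forall b i, (0 < i)%N -> obj nu (fun=> 0%R) (b, i) = cost_sup%:E.
Proof.
apply: (@relative_canonical _ _ _ c nu _ never_value).
- exact: never_value1.
- exact: never_value_eq.
- exact: stationary_never.
- by move=> x _; right; split=> //; exact: never_value_le.
- move=> tau st b i i0.
  apply: (@relative_lower_bound _ _ _ c nu _ never_value hlambda hmu never_value1
    never_value_eq c (Num.max cost_sup (nu / mu))) => //.
  + by move=> x x0; exact: hc.1.
  + by move=> x x0; rewrite le_max cost_le_sup.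
  move=> [//|x] _; rewrite le_max; apply/orP; right.
  by rewrite ler_pdivlMr// mulrC never_value_le.
exact: never_objective_le.
Qed.

End Never.

(** Converse to [relative_canonical]: averaging [h] over the packet indicator and normalizing at AoI
    1 turns the optimality equations into the scalar recursion. *)
Lemma canonical_relative_value nu sigma : canonical_optimal lambda mu c nu sigma ->
  exists eta u, [/\ forall b i, (0 < i)%N -> obj nu sigma (b, i) = eta%:E,
    u 1 = 0,
    forall x, (0 < x)%N ->
      u x = c x - eta + u x.+1 + lambda * Num.min 0 (nu - mu * u x.+1),
    forall x, (0 < x)%N -> 0 < sigma x -> nu <= mu * u x.+1 &
    forall x, (0 < x)%N -> sigma x < 1 -> mu * u x.+1 <= nu].
Proof.
move=> [[st _] [eta [h [objE hopt hact]]]].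
pose u x := arrival_mean lambda h x - arrival_mean lambda h 1.
exists eta, u; split => //.
- by rewrite /u subrr.
- move=> x x0; have [hf ht] := hopt x x0.
  rewrite {1}/u /arrival_mean hf ht /q_value /trans_mean/=.
  rewrite -![lambda * h (true, _) + _]/(arrival_mean lambda h _).
  rewrite /u; set a := arrival_mean _ _ 1; set b := arrival_mean _ _ _.
  by rewrite !minEle; case: ifP => h1; case: ifP => h2; lra.
- move=> x x0 s0; have [_ ht] := hopt x x0; have := hact true x x0.
  rewrite ht /act_mean /q_value /trans_mean/= minEle.
  by have := st _ x0; rewrite /u; case: ifP; nra.
- move=> x x0 s1; have [_ ht] := hopt x x0; have := hact true x x0.
  rewrite ht /act_mean /q_value /trans_mean/= minEle.
  by have := st _ x0; rewrite /u; case: ifP; nra.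
Qed.

End Whittle.

(** * Identification of the optimal actions *)

Section WhittleIndex.
Context {R : realType}.
Variables (lambda mu : R) (c : nat -> R).
Hypotheses (hlambda : 0 < lambda <= 1) (hmu : 0 < mu <= 1).
Hypotheses (hc : nonneg_nondecreasing c) (hs : tail_summable (1 - lambda * mu) c).

Local Notation p := (lambda * mu).
Local Notation q := (1 - lambda * mu).
Local Notation m := (mp_index lambda mu c).
Local Notation gain := (threshold_gain lambda mu c).
Local Notation U := (relative_value lambda mu c).
Local Notation obj := (avg_objective lambda mu c).

Let p0 : 0 < p. Proof. by case/andP: (success_prob_bounds hlambda hmu). Qed.
Let p1 : p <= 1. Proof. by case/andP: (success_prob_bounds hlambda hmu). Qed.
Let m0 : 0 < mu. Proof. by case/andP: hmu. Qed.
Let q0 : 0 <= q. Proof. by rewrite subr_ge0. Qed.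
Let kp0 k : 0 < 1 + k%:R * p.
Proof. by rewrite ltr_wpDr// mulr_ge0 ?ler0n// ltW. Qed.
Let mp_ge0 j : 0 <= m j. Proof. exact: mp_index_ge0. Qed.
Let mp_homo i j : (i <= j)%N -> m i <= m j. Proof. exact: mp_index_homo. Qed.
Let mp0 : m 0 = 0. Proof. exact: mp_index0. Qed.

Lemma threshold_range_of_le nu j : (0 < j)%N -> 0 < nu -> nu <= m j ->
  exists k, m k < nu <= m k.+1.
Proof.
move=> j0 nu0 nuj; have [|n nun nmin] := @ex_minnP (fun n => nu <= m n).
  by exists j.
case: n nun nmin => [|k] nun nmin; first by move: nun; rewrite mp0 leNgt nu0.
by exists k; rewrite nun andbT ltNge; apply/negP => /nmin; rewrite ltnn.
Qed.

(** When indices coincide, several thresholds are optimal. For nu >= 0 this picks the largest, which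
    idles wherever m_j <= nu; [threshold_range_of_le] picks the smallest, which attempts wherever
    m_j >= nu. *)
Lemma threshold_range_of_lt nu j : (0 < j)%N -> nu < m j ->
  exists k, [/\ (k < j)%N, threshold_range lambda mu c k nu & nu < m k.+1].
Proof.
move=> j0 nuj; have [nu0|nu0] := leP 0 nu; last first.
  exists 0%N; split=> //; first by apply: Or33; split=> //; exact: ltW.
  exact: lt_le_trans (mp_ge0 1).
have [|n nun nmin] := @ex_minnP (fun n => nu < m n); first by exists j.
case: n nun nmin => [|k] nun nmin; first by move: nun; rewrite mp0 ltNge nu0.
exists k; split=> //; first exact: nmin.
apply: Or31; split=> //.
by rewrite nun andbT leNgt; apply/negP => /nmin; rewrite ltnn.
Qed.

Lemma threshold_range_ex nu j : (0 < j)%N -> nu <= m j ->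
  exists2 k, (k < j)%N & threshold_range lambda mu c k nu.
Proof.
move=> j0 nuj; have [nu0|nu0] := leP nu 0; first by exists 0%N => //; apply: Or33.
have [k /andP[kn nuk]] := threshold_range_of_le j0 nu0 nuj.
exists k; last by apply: Or32; rewrite kn.
by rewrite ltnNge; apply/negP => /mp_homo jk; move: (le_trans nuj jk); rewrite leNgt kn.
Qed.

Lemma mp_index_bounded_or nu :
  (exists2 n, (0 < n)%N & nu < m n) \/ (forall n, m n <= nu).
Proof.
have [[n nun]|nonu] := pselect (exists n, nu < m n).
  by left; exists n.+1 => //; apply: lt_le_trans nun (mp_homo (leqnSn n)).
by right=> n; rewrite leNgt; apply/negP => nun; apply: nonu; exists n.
Qed.

Lemma optimal_attempt nu j : (0 < j)%N -> nu <= m j ->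
  optimal_action lambda mu c nu true j.
Proof.
move=> j0 nuj; have [k kj kr] := threshold_range_ex j0 nuj.
exists (threshold k); split; last by rewrite /threshold kj.
by case: (threshold_canonical hlambda hmu hc hs kr).
Qed.

Lemma optimal_idle nu j : m j <= nu -> optimal_action lambda mu c nu false j.
Proof.
move=> jnu; have [[n n0 nun]|all_le] := mp_index_bounded_or nu.
  have [k [_ kr nuk]] := threshold_range_of_lt n0 nun.
  exists (threshold k); split; first by case: (threshold_canonical hlambda hmu hc hs kr).
  rewrite /threshold ltnNge (_ : (j <= k)%N)// leqNgt; apply/negP => /mp_homo kj.
  by move: (le_lt_trans (le_trans kj jnu) nuk); rewrite ltxx.
exists (fun=> 0); split=> //.
by case: (never_canonical hlambda hmu hc hs all_le).
Qed.

Lemma canonical_same_value nu sigma sigma' eta eta' :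
  canonical_optimal lambda mu c nu sigma -> canonical_optimal lambda mu c nu sigma' ->
  (forall b i, (0 < i)%N -> obj nu sigma (b, i) = eta%:E) ->
  (forall b i, (0 < i)%N -> obj nu sigma' (b, i) = eta'%:E) -> eta = eta'.
Proof.
move=> [[st opt] _] [[st' opt'] _] E E'.
have := opt _ st' true 1%N isT; have := opt' _ st true 1%N isT.
by rewrite E// E'// !lee_fin => h1 h2; apply/eqP; rewrite eq_le h1 h2.
Qed.

(** If m_j < nu, some threshold k >= j with m_k < nu, or never attempting, is optimal and strictly
    prefers idling in (1, j). Uniqueness below the threshold carries this preference over to any
    canonical policy. *)
Lemma optimal_attempt_le nu j : (0 < j)%N ->
  optimal_action lambda mu c nu true j -> nu <= m j.
Proof.
move=> j0 [sigma [can sj]]; rewrite leNgt; apply/negP => jnu.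
have [eta [u [objE u1 u_eq act1 _]]] := canonical_relative_value can.
have nu0 : 0 < nu := le_lt_trans (mp_ge0 j) jnu.
have := act1 j j0; rewrite sj ltr01 => /(_ isT); apply/negP; rewrite -ltNge.
have [[n n0 nun]|none] := pselect (exists2 n, (0 < n)%N & nu <= m n).
  have [k /andP[knu nuk]] := threshold_range_of_le n0 nu0 nun.
  have jk : (j <= k)%N.
    rewrite leqNgt; apply/negP => /mp_homo kj.
    by move: (le_lt_trans (le_trans nuk kj) jnu); rewrite ltxx.
  have kr : threshold_range lambda mu c k nu by apply: Or32; rewrite knu.
  have [can' objE'] := threshold_canonical hlambda hmu hc hs kr.
  have eqeta := canonical_same_value can can' objE objE'.
  have Ult x : (0 < x <= k)%N -> mu * U k nu x.+1 < nu.
    move=> xk; apply: (@le_lt_trans _ _ (mu * U k nu k.+1)).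
      rewrite ler_pM2l//; apply: relative_value_le => //; exact: ltW.
    by rewrite -subr_lt0 relative_value_threshold// pmulr_llt0 ?invr_gt0// subr_lt0.
  have /andP[knu' nuk'] := threshold_range_le hlambda hmu hc hs kr.
  have U1 := relative_value1 hlambda hmu c k nu.
  rewrite (@relative_value_unique_below _ lambda mu c nu eta (U k nu) hlambda hmu _ _ u k)//.
    by rewrite Ult// j0.
  by rewrite eqeta => x x0; apply: relative_value_eq.
have m_lt n : (0 < n)%N -> m n < nu.
  by move=> n0; rewrite ltNge; apply/negP => nun; apply: none; exists n.
have m_le n : m n <= nu by case: n => [|n]; [rewrite mp0 ltW | exact/ltW/m_lt].
have [can' objE'] := never_canonical hlambda hmu hc hs m_le.
have eqeta := canonical_same_value can can' objE objE'.
rewrite (@relative_value_unique_below _ lambda mu c nu eta (never_value c) hlambda hmu _ _ u j)//.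
- exact: (never_value_lt hlambda hmu hc hs m_le m_lt).
- exact: never_value1.
- by rewrite eqeta; exact: (never_value_eq hlambda hmu hc hs m_le).
by move=> x /andP[x0 _]; exact: (never_value_lt hlambda hmu hc hs m_le m_lt).
Qed.

Lemma mean_at_never sigma g f t b i : (0 < i)%N ->
  (forall x, (i <= x)%N -> sigma x = 0) ->
  (forall b x, g (b, x) false = f x) ->
  mean_at lambda mu (fun=> sigma) g t (b, i) = f (i + t)%N.
Proof.
move=> i0 sig0 gf; elim: t b i i0 sig0 => [|t IH] b i i0 sig0.
  rewrite mean_at0 /act_mean/= sig0// !gf addn0.
  by case: b; rewrite ?mul0r ?add0r ?subr0 ?mul1r.
have sig1 x : (i.+1 <= x)%N -> sigma x = 0 by move=> ix; rewrite sig0// ltnW.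
rewrite mean_atS /act_mean/= sig0// /trans_mean/= ?andbF /arrival_mean !(IH _ i.+1)//.
by rewrite addSnnS; case: b; ring.
Qed.

Lemma avg_objective_never_ge nu sigma b i : stationary sigma -> (0 < i)%N ->
  (forall x, (i <= x)%N -> sigma x = 0) -> ((c i)%:E <= obj nu sigma (b, i))%E.
Proof.
move=> st i0 sig0.
have -> : obj nu sigma (b, i) = avg_cost lambda mu c sigma (b, i).
  rewrite /avg_objective (_ : avg_work _ _ _ _ = 0%E) ?mule0 ?adde0//.
  apply/eqP; rewrite eq_le avg_work_ge0// andbT.
  apply: (@long_run_average_le _ _ _ _ _ _ _ 0) => T.
  rewrite mulr0 addr0 big1// => t _.
  by rewrite (@mean_at_never _ _ (fun=> 0)).
apply: (@long_run_average_ge _ _ _ _ _ _ _ 0) => T.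
rewrite subr0 mulr_natl -[X in _ *+ X]subn0 -sumr_const_nat.
apply: ler_sum => t _; rewrite (@mean_at_never _ _ c)//.
by apply: hc.2 => //; exact: leq_addr.
Qed.

(** If nu < m_j, some optimal threshold k < j strictly prefers attempting above k. For p < 1 the
    relative values are unique, which excludes idling in (1, j). *)
Lemma optimal_idle_le nu j : (0 < j)%N ->
  optimal_action lambda mu c nu false j -> m j <= nu.
Proof.
move=> j0 [sigma [can sj]]; rewrite leNgt; apply/negP => nuj.
have [eta [u [objE u1 u_eq act1 act0]]] := canonical_relative_value can.
have [k [kj kr nuk]] := threshold_range_of_lt j0 nuj.
have [can' objE'] := threshold_canonical hlambda hmu hc hs kr.
have eqeta := canonical_same_value can can' objE objE'.
have Uk : nu < mu * U k nu k.+2.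
  by rewrite -subr_gt0 relative_value_thresholdS// divr_gt0 ?subr_gt0.
have /andP[knu' nuk'] := threshold_range_le hlambda hmu hc hs kr.
have U1 := relative_value1 hlambda hmu c k nu.
have uj : mu * u j.+1 <= nu by apply: act0; rewrite ?sj ?ltr01.
have [p_lt1|p_ge1] := ltP p 1.
  move: uj; apply/negP; rewrite -ltNge.
  rewrite (@relative_value_unique _ lambda mu c nu eta (U k nu) hlambda hmu _ _ u)//.
    by apply: (lt_le_trans Uk); rewrite ler_pM2l// relative_value_ge.
  by rewrite eqeta => x x0; apply: relative_value_eq.
(* Without failures, the values above the threshold are not determined by the
   optimality equations; an idle action there would propagate to all larger
   AoI values and make the objective exceed its optimal value. *)
have pE : p = 1 by apply/eqP; rewrite eq_le p1.
have /andP[_ l1] := hlambda; have /andP[_ mu1] := hmu.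
have muE : mu = 1 by apply/eqP; rewrite eq_le mu1 -pE ler_piMl// ltW.
have lE : lambda = 1 by rewrite -pE muE mulr1.
have S_c x : (0 < x)%N -> tail_sum q c x = c x.
  by move=> x0; rewrite (tail_sumE q0 hc hs x0) pE subrr mul0r addr0.
(* For q = 0 the tail sum is its first term, so [Uk] reads nu < c_(k+2) + nu - eta. *)
have c_gt x : (k.+1 < x)%N -> eta < c x.
  move=> kx; apply: (@lt_le_trans _ _ (c k.+2)); last by apply: hc.2.
  move: Uk; rewrite relative_value_gt// -eqeta S_c// pE muE !divr1 mul1r; lra.
(* With lambda = mu = 1 the recursion is u_(x+1) = c_(x+1) - eta + min(u_(x+2), nu), and c_(x+1) >
   eta. *)
have u_step x : (j <= x)%N -> mu * u x.+1 <= nu -> mu * u x.+2 < nu.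
  move=> jx; have := u_eq x.+1 isT; have := c_gt x.+1.
  rewrite ltnS (leq_trans kj jx) => /(_ isT).
  by rewrite muE lE !mul1r minEle; case: ifP => ? ? ? ?; lra.
have u_le n : mu * u (j + n).+1 <= nu.
  elim: n => [|n IH]; first by rewrite addn0.
  by rewrite addnS; apply/ltW/u_step => //; exact: leq_addr.
have [[st _] _] := can.
have sig0 x : (j < x)%N -> sigma x = 0.
  case: x => // x; rewrite ltnS => jx; apply/eqP; rewrite eq_le.
  have /andP[-> _] := st x.+1 isT; rewrite andbT leNgt; apply/negP => /act1-/(_ isT).
  by apply/negP; rewrite -ltNge; apply: u_step => //; rewrite -(subnKC jx); exact: u_le.
have := @avg_objective_never_ge nu sigma true j.+1 st isT sig0.
by rewrite objE// lee_fin leNgt c_gt.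
Qed.

Lemma whittle_mp_index : whittle_index lambda mu c m.
Proof.
move=> nu j j0; split; split.
- exact: optimal_attempt_le.
- exact: optimal_attempt.
- exact: optimal_idle_le.
- exact: optimal_idle.
Qed.

Lemma threshold_optimal nu : exists k, avg_optimal lambda mu c nu (ext_threshold k).
Proof.
have [[n n0 nun]|all_le] := mp_index_bounded_or nu.
  have [k [_ kr _]] := threshold_range_of_lt n0 nun; exists (Some k).
  by case: (threshold_canonical hlambda hmu hc hs kr) => -[].
by exists None; case: (never_canonical hlambda hmu hc hs all_le) => -[].
Qed.

(** At the charge m_j both actions are optimal, which bounds [nus j] from both sides. *)
Lemma whittle_index_unique nus : whittle_index lambda mu c nus ->
  forall j, (0 < j)%N -> nus j = m j.
Proof.
move=> W j j0; have [a1 i1] := W (m j) j j0; have [a2 i2] := whittle_mp_index (m j) j0.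
by apply/eqP; rewrite eq_le; apply/andP; split; [apply/i1/i2|apply/a1/a2].
Qed.

End WhittleIndex.

(** * Discounted values and the MP index *)

Section Discounted.
Context {R : realType}.
Variables (lambda mu : R) (c : nat -> R) (k : nat) (nu : R).
Hypotheses (hlambda : 0 < lambda <= 1) (hmu : 0 < mu <= 1).
Hypotheses (hc : nonneg_nondecreasing c) (hs : tail_summable (1 - lambda * mu) c).
Hypothesis nu0 : 0 <= nu.

Local Notation p := (lambda * mu).
Local Notation q := (1 - lambda * mu).

Let p0 : 0 < p. Proof. by case/andP: (success_prob_bounds hlambda hmu). Qed.
Let p1 : p <= 1. Proof. by case/andP: (success_prob_bounds hlambda hmu). Qed.
Let l0 : 0 < lambda. Proof. by case/andP: hlambda. Qed.
Let m0 : 0 < mu. Proof. by case/andP: hmu. Qed.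
Let m1 : mu <= 1. Proof. by case/andP: hmu. Qed.
Let q0 : 0 <= q. Proof. by rewrite subr_ge0. Qed.

(* (1 - beta) / (1 - q beta) times the discounted value at AoI 1. *)
Definition scaled_value1 (beta : R) : R :=
  (\sum_(1 <= l < k.+1) beta ^+ (l - 1) * c l +
     beta ^+ k * (tail_sum (q * beta) c k.+1 + lambda * nu / (1 - q * beta))) /
  (1 + p * beta * \sum_(0 <= l < k) beta ^+ l).

Definition discounted_value1 (beta : R) : R :=
  (1 - q * beta) * scaled_value1 beta / (1 - beta).

Definition discounted_value (beta : R) : nat -> R :=
  threshold_value lambda mu beta c k nu 0 (discounted_value1 beta).

Definition discounted_state_value (beta : R) : state -> R :=
  threshold_state_value lambda mu beta c k nu 0 (discounted_value1 beta).

Section FixedDiscount.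
Variable beta : R.
Hypothesis hbeta : 0 < beta < 1.

Let b0 : 0 < beta. Proof. by case/andP: hbeta. Qed.
Let b1 : beta < 1. Proof. by case/andP: hbeta. Qed.
Let b01 : 0 < beta <= 1. Proof. by rewrite b0 ltW. Qed.
Let qb0 : 0 <= q * beta. Proof. by rewrite mulr_ge0// ltW. Qed.
Let qb1 : 0 < 1 - q * beta.
Proof. by case/andP: (discounted_failure_bounds hlambda hmu b01); rewrite subr_gt0. Qed.

Lemma tail_summable_discount : tail_summable (q * beta) c.
Proof.
apply: (@tail_summable_le _ _ q c c) => //.
  by rewrite qb0 ler_piMr// ltW.
by move=> i i0; rewrite hc.1//=.
Qed.
Let hsb := tail_summable_discount.

Let den0 : 0 < 1 + p * beta * \sum_(0 <= l < k) beta ^+ l.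
Proof.
rewrite ltr_wpDr// mulr_ge0 ?(mulr_ge0 (ltW p0) (ltW b0))// sumr_ge0// => l _.
by rewrite exprn_ge0// ltW.
Qed.

Lemma discounted_value_1 : discounted_value beta 1 = discounted_value1 beta.
Proof.
rewrite /discounted_value threshold_value1//; under eq_bigr => l _ do rewrite subr0.
rewrite /tail_value subr0 /discounted_value1 /scaled_value1.
have := subrX1 beta k; rewrite -(big_mkord xpredT (fun i => beta ^+ i)) => bk.
(* With G the geometric sum, 1 - q beta - p beta^(k+1) = (1 - beta) (1 + p beta G); this is the
   origin of the denominators of [scaled_value1] and [discounted_value1]. *)
move: den0; have -> : beta ^+ k = 1 + (beta - 1) * \sum_(0 <= l < k) beta ^+ l.
  by rewrite -bk; ring.
set G := \sum_(0 <= l < k) _; set A := \sum_(1 <= l < k.+1) _ => G0.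
have b1n : 1 - beta != 0 by rewrite subr_eq0 gt_eqF.
by field; rewrite b1n !gt_eqF.
Qed.

Lemma discounted_value1_ge0 : 0 <= discounted_value1 beta.
Proof.
rewrite /discounted_value1 divr_ge0 ?subr_ge0 ?(ltW b1)// mulr_ge0 ?(ltW qb1)//.
rewrite divr_ge0 ?(ltW den0)// addr_ge0//.
  rewrite big_nat_cond sumr_ge0// => l /andP[/andP[l1 _] _].
  by rewrite mulr_ge0 ?exprn_ge0 ?(ltW b0)// hc.1.
rewrite mulr_ge0 ?exprn_ge0 ?(ltW b0)// addr_ge0 ?tail_sum_ge0//.
by rewrite divr_ge0 ?(ltW qb1)// mulr_ge0// ltW.
Qed.

Lemma discounted_value_ge0 x : (0 < x)%N -> 0 <= discounted_value beta x.
Proof.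
move=> x0; have tail0 y : (0 < y)%N ->
    0 <= tail_value lambda mu beta c nu 0 (discounted_value1 beta) y.
  move=> y0; rewrite /tail_value addr_ge0 ?tail_sum_ge0// divr_ge0 ?(ltW qb1)//.
  rewrite subr0 addr_ge0// mulr_ge0 ?discounted_value1_ge0// ?(ltW l0)//.
  by rewrite mulr_ge0 ?(ltW p0) ?(ltW b0).
rewrite /discounted_value /threshold_value; case: ifP => _; last exact: tail0.
rewrite addr_ge0 ?mulr_ge0 ?exprn_ge0 ?(ltW b0) ?tail0//.
rewrite big_nat_cond sumr_ge0// => l /andP[/andP[xl _] _].
rewrite subr0 mulr_ge0 ?exprn_ge0 ?(ltW b0)// hc.1//; exact: leq_trans xl.
Qed.

Lemma discounted_state_value_ge0 b i : (0 < i)%N ->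
  0 <= discounted_state_value beta (b, i).
Proof.
move=> i0; rewrite /discounted_state_value /threshold_state_value/= subr0.
rewrite addr_ge0 ?hc.1//; have := @discounted_value_ge0 i.+1 isT.
rewrite -/(discounted_value beta); have := discounted_value1_ge0.
move=> v0 w0; case: ifP => _; last by rewrite mulr_ge0// ltW.
rewrite addr_ge0// mulr_ge0 ?(ltW b0)// addr_ge0// mulr_ge0 ?subr_ge0//.
exact: ltW.
Qed.

Lemma discounted_state_valueE b i : (0 < i)%N ->
  discounted_state_value beta (b, i) = act_mean (threshold k) (b, i) (fun a =>
    stage_cost c nu (b, i) a - 0 +
    beta * trans_mean lambda mu (b, i) a (discounted_state_value beta)).
Proof.
move=> i0; apply: threshold_state_valueE => //; exact: discounted_value_1.
Qed.

Lemma discounted_sum T b i : (0 < i)%N ->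
  \sum_(0 <= t < T)
    mean_at lambda mu (fun=> threshold k) (stage_cost c nu) t (b, i) * beta ^+ t +
  beta ^+ T * mean_at lambda mu (fun=> threshold k)
    (fun s _ => discounted_state_value beta s) T (b, i) =
  discounted_state_value beta (b, i).
Proof.
move=> i0; have st : stationary (@threshold R k) by exact: stationary_threshold.
apply/eqP; rewrite eq_le; apply/andP; split.
  have := @mean_sum_supersolution _ _ _ hlambda hmu _ (stage_cost c nu)
    (discounted_state_value beta) beta 0 T b i st (ltW b0) _ i0.
  under eq_bigr => t _ do rewrite subr0.
  by apply=> b' i' i'0; rewrite [leRHS]discounted_state_valueE.
have := @mean_sum_subsolution _ _ _ hlambda hmu _ (stage_cost c nu)
  (discounted_state_value beta) beta 0 T b i st (ltW b0) _ i0.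
under eq_bigr => t _ do rewrite subr0.
by apply=> b' i' i'0; rewrite [leLHS]discounted_state_valueE.
Qed.

End FixedDiscount.

Let stage_ge0 b i a : (0 < i)%N -> 0 <= stage_cost c nu (b, i) a.
Proof. by move=> i0; rewrite /stage_cost/= addr_ge0 ?hc.1// mulr_ge0. Qed.

Lemma discounted_value_dominated beta beta' : 0 < beta -> beta <= beta' -> beta' < 1 ->
  exists M, forall x, (0 < x)%N -> discounted_value beta x <= discounted_value beta' x + M.
Proof.
move=> b0 bb' b'1.
have hb : 0 < beta < 1 by rewrite b0 (le_lt_trans bb').
have hb' : 0 < beta' < 1 by rewrite b'1 (lt_le_trans b0).
pose K b := (lambda * nu - 0 + p * b * discounted_value1 b) / (1 - q * b).
(* Above k the tail sums are monotone in beta and the constants [K] differ by a fixed amount; up to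
   k the values are summed, with index 0 switched off. *)
pose D := `|K beta - K beta'| + \sum_(0 <= l < k.+1) discounted_value beta l *+ (0 < l).
have D0 l : 0 <= discounted_value beta l *+ (0 < l).
  by case: l => [|l]; rewrite ?mulr0n// mulr1n discounted_value_ge0.
exists D => x x0; rewrite /D; case: (leqP x k) => xk.
  have : discounted_value beta x <=
      \sum_(0 <= l < k.+1) discounted_value beta l *+ (0 < l).
    rewrite (big_rem x) ?mem_index_iota ?ltnS//= x0 mulr1n lerDl.
    exact: sumr_ge0.
  have := discounted_value_ge0 hb' x0; have := normr_ge0 (K beta - K beta'); lra.
have : 0 <= \sum_(0 <= l < k.+1) discounted_value beta l *+ (0 < l) by exact: sumr_ge0.
have : tail_sum (q * beta) c x <= tail_sum (q * beta') c x.
  apply: ler_tail_sum => //; last exact: tail_summable_discount.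
    by rewrite mulr_ge0 ?(ltW b0)//= ler_wpM2l.
  by move=> i i0; rewrite hc.1/=.
have := ler_norm (K beta - K beta').
rewrite /discounted_value !threshold_value_gt// /tail_value -/(K beta) -/(K beta').
lra.
Qed.

Lemma discounted_state_value_dominated beta beta' :
  0 < beta -> beta <= beta' -> beta' < 1 -> exists M, forall b i, (0 < i)%N ->
  discounted_state_value beta (b, i) <= discounted_state_value beta' (b, i) + M.
Proof.
move=> b0 bb' b'1; have [M MP] := discounted_value_dominated b0 bb' b'1.
have hb : 0 < beta < 1 by rewrite b0 (le_lt_trans bb').
have hb' : 0 < beta' < 1 by rewrite b'1 (lt_le_trans b0).
have v0 := discounted_value1_ge0 hb; have v0' := discounted_value1_ge0 hb'.
exists (`|M| + discounted_value1 beta) => b i i0.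
rewrite /discounted_state_value /threshold_state_value/= -!/(discounted_value _).
have := MP i.+1 isT; have w0' := discounted_value_ge0 hb' (ltn0Sn i).
have w0 := discounted_value_ge0 hb (ltn0Sn i).
set w := discounted_value beta _ in w0 *; set w' := discounted_value beta' _ in w0' *.
have := ler_norm M; have := normr_ge0 M; set M' := `|M| => M0 MM ww.
have wM : w <= w' + M' by lra.
have b'0 : 0 <= beta' by case/andP: hb' => /ltW.
have bw : beta * w <= beta' * w' + M'.
  have := ler_wpM2r w0 bb'; have := ler_wpM2l b'0 wM.
  by have := ler_piMl M0 (ltW b'1); rewrite mulrDr; lra.
case: ifP => _; last by lra.
have h1 : beta * (mu * discounted_value1 beta) <= discounted_value1 beta.
  have /andP[_ /ltW b1] := hb.
  by rewrite mulrA ler_piMl// mulr_ile1 ?(ltW b0) ?(ltW m0).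
have h2 := mulr_ge0 b'0 (mulr_ge0 (ltW m0) v0').
have h3 : (1 - mu) * (beta * w) <= (1 - mu) * (beta' * w' + M').
  by rewrite ler_wpM2l// subr_ge0.
have h4 : (1 - mu) * M' <= M' by rewrite ler_piMl// gerBl ltW.
rewrite !mulrDr (mulrCA beta (1 - mu)) (mulrCA beta' (1 - mu)).
move: h3; rewrite mulrDr; lra.
Qed.

(* The remainder beta^T E V(Y_T) is controlled by comparison with the values for
   a larger discount factor beta', for which beta'^T E V'(Y_T) stays bounded. *)
Lemma discounted_sum_cvg beta b i : 0 < beta < 1 -> (0 < i)%N ->
  \sum_(0 <= t < T)
    mean_at lambda mu (fun=> threshold k) (stage_cost c nu) t (b, i) * beta ^+ t
    @[T --> \oo] --> discounted_state_value beta (b, i).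
Proof.
move=> /andP[b0 b1] i0; pose beta' := (1 + beta) / 2.
have bb' : beta < beta' by rewrite /beta'; lra.
have b'1 : beta' < 1 by rewrite /beta'; lra.
have hb : 0 < beta < 1 by rewrite b0.
have hb' : 0 < beta' < 1 by rewrite b'1 (lt_trans b0).
have b'0 : 0 < beta' by case/andP: hb'.
have st : stationary (@threshold R k) by exact: stationary_threshold.
have [M MP] := discounted_state_value_dominated b0 (ltW bb') b'1.
pose rem T := beta ^+ T * mean_at lambda mu (fun=> threshold k)
    (fun s _ => discounted_state_value beta s) T (b, i).
have rem0 : rem T @[T --> \oo] --> 0.
  (* By [discounted_sum], beta'^T E V'(Y_T) <= V'(b, i), so the domination bounds the remainder by
     this sequence. *)
  have h0 : (beta / beta') ^+ T * discounted_state_value beta' (b, i) + beta ^+ T * M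
      @[T --> \oo] --> 0 * discounted_state_value beta' (b, i) + 0 * M.
    apply: cvgD; apply: cvgMr_tmp; apply: cvg_expr; rewrite ger0_norm//.
    - by rewrite ltr_pdivrMr// mul1r.
    - by rewrite divr_ge0 ?ltW.
    - exact: ltW.
  rewrite !mul0r addr0 in h0; apply: (squeeze_cvgr _ (cvg_cst 0) h0).
  near=> T; apply/andP; split.
    rewrite mulr_ge0 ?exprn_ge0 ?(ltW b0)//; apply: mean_at_ge0 => // *.
    exact: discounted_state_value_ge0.
  have : mean_at lambda mu (fun=> threshold k)
      (fun s _ => discounted_state_value beta s) T (b, i) <=
      mean_at lambda mu (fun=> threshold k)
      (fun s _ => discounted_state_value beta' s) T (b, i) + M.
    rewrite -[X in _ <= X + _]mul1r -[M in leRHS]mulr1.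
    rewrite -[X in _ <= _ + _ * X](mean_at_const lambda mu (threshold k) 1 T (b, i)).
    rewrite -mean_at_lin; apply: mean_at_le => // b' i' _ i'0.
    by rewrite mul1r mulr1 MP.
  move/(ler_wpM2l (exprn_ge0 T (ltW b0)))/le_trans; apply.
  rewrite mulrDr lerD2r expr_div_n -mulrA ler_wpM2l ?exprn_ge0 ?(ltW b0)//.
  rewrite mulrC ler_pdivlMr ?exprn_gt0// mulrC.
  rewrite -(discounted_sum hb' T b i0) lerDr sumr_ge0// => t _.
  by rewrite mulr_ge0 ?exprn_ge0 ?(ltW b'0)//; apply: mean_at_ge0.
have -> : (fun T => \sum_(0 <= t < T)
    mean_at lambda mu (fun=> threshold k) (stage_cost c nu) t (b, i) * beta ^+ t) =
    (fun T => discounted_state_value beta (b, i) - rem T).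
  by apply/funext => T; rewrite -(discounted_sum hb T b i0) addrK.
rewrite -[X in _ --> X]subr0; apply: cvgB => //; exact: cvg_cst.
Unshelve. all: by end_near. Qed.

(** Conditioning on the first transition leaves discounted sums of the k-policy, whose limits are
    known. The identity is proved for finite sums and then passed to the limit. *)
Lemma discounted_act_then_threshold beta a i : 0 < beta < 1 -> (0 < i)%N ->
  discounted lambda mu beta (stage_cost c nu) (act_then_threshold a k) (true, i) =
  (c i + nu * a%:R + beta *
    (if a then mu * discounted_value1 beta + (1 - mu) * discounted_value beta i.+1
     else discounted_value beta i.+1))%:E.
Proof.
move=> hb i0; have /andP[b0 b1] := hb; pose m t s :=
  mean_at lambda mu (fun=> threshold k) (stage_cost c nu) t s.
pose D s T := \sum_(0 <= t < T) m t s * beta ^+ t.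
have arrE x : (0 < x)%N ->
    arrival_mean lambda (discounted_state_value beta) x = discounted_value beta x.
  move=> x0; apply: arrival_mean_threshold => //; first by rewrite b0 ltW.
  exact: tail_summable_discount.
have cvg_arr x : (0 < x)%N ->
    arrival_mean lambda (fun s => D s T) x @[T --> \oo] --> discounted_value beta x.
  move=> x0; rewrite -arrE// /arrival_mean.
  by apply: cvgD; apply: cvgMl_tmp; exact: discounted_sum_cvg.
have arr_sum x T : arrival_mean lambda (fun s => D s T) x =
    \sum_(0 <= t < T) arrival_mean lambda (m t) x * beta ^+ t.
  rewrite /arrival_mean /D !mulr_sumr -big_split/=.
  by apply: eq_bigr => t _; ring.
pose x := c i + nu * a%:R.
pose tr T := if a then mu * arrival_mean lambda (fun s => D s T) 1 +
    (1 - mu) * arrival_mean lambda (fun s => D s T) i.+1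
  else arrival_mean lambda (fun s => D s T) i.+1.
have partialE T : \sum_(0 <= t < T.+1) mean_at lambda mu (act_then_threshold a k)
    (stage_cost c nu) t (true, i) * beta ^+ t = x + beta * tr T.
  rewrite big_nat_recl// expr0 mulr1; congr (_ + _).
    by rewrite mean_at0 /act_mean/= /stage_cost/= /x; case: (a); rewrite /=; ring.
  transitivity (\sum_(0 <= t < T) beta * (trans_mean lambda mu (true, i) a (m t) * beta ^+ t)).
    apply: eq_bigr => t _; rewrite mean_atS exprS mulrCA; congr (_ * (_ * _)).
    by rewrite /act_mean/= /m; case: (a); rewrite /=; ring.
  rewrite -mulr_sumr /tr !arr_sum /trans_mean/=; congr (_ * _).
  case: (a); last by [].
  by rewrite !mulr_sumr -big_split/=; apply: eq_bigr => t _; ring.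
apply/cvg_lim => //; rewrite -cvg_shiftS /=.
have -> : (fun n => (\sum_(0 <= t < n.+1) (mean_at lambda mu (act_then_threshold a k)
    (stage_cost c nu) t (true, i) * beta ^+ t)%:E)%E) = (fun n => (x + beta * tr n)%:E).
  by apply/funext => T; rewrite sumEFin partialE.
apply: cvg_EFin; first by near=> T.
apply: cvgD; first exact: cvg_cst.
apply: cvgMl_tmp; rewrite /tr; case: (a); last exact: cvg_arr.
apply: cvgD; apply: cvgMl_tmp; last exact: cvg_arr.
by rewrite -discounted_value_1//; exact: cvg_arr.
Unshelve. all: by end_near. Qed.

End Discounted.

(** * The limit beta -> 1 and the MP index *)

Section MarginalProductivity.
Context {R : realType}.
Variables (lambda mu : R).
Hypotheses (hlambda : 0 < lambda <= 1) (hmu : 0 < mu <= 1).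

Local Notation p := (lambda * mu).
Local Notation q := (1 - lambda * mu).

Let p0 : 0 < p. Proof. by case/andP: (success_prob_bounds hlambda hmu). Qed.
Let p1 : p <= 1. Proof. by case/andP: (success_prob_bounds hlambda hmu). Qed.
Let l0 : 0 < lambda. Proof. by case/andP: hlambda. Qed.
Let m0 : 0 < mu. Proof. by case/andP: hmu. Qed.
Let q0 : 0 <= q. Proof. by rewrite subr_ge0. Qed.
Let kp0 k : 0 < 1 + k%:R * p.
Proof. by rewrite ltr_wpDr// mulr_ge0 ?ler0n// ltW. Qed.

(** An Abelian limit: (1 - beta) V(1) tends to the gain and 1 - q beta to p. Each factor of the
    closed form converges, the pole at beta = 1 having been removed. *)
Lemma scaled_value1_cvg (c : nat -> R) k nu :
  nonneg_nondecreasing c -> tail_summable q c ->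
  scaled_value1 lambda mu c k nu beta @[beta --> 1^'-] -->
    threshold_gain lambda mu c k nu / p.
Proof.
move=> hc hs.
have bX n : beta ^+ n @[beta --> (1 : R)^'-] --> (1 : R).
  rewrite -[X in _ --> X](expr1n R n); apply: cvg_at_left_filter.
  exact: exprn_continuous.
have b1 : beta @[beta --> (1 : R)^'-] --> (1 : R) by exact: (bX 1%N).
have qb : 1 - q * beta @[beta --> (1 : R)^'-] --> p.
  rewrite [X in _ --> X](_ : p = 1 - q * 1); last by ring.
  by apply: cvgB; [exact: cvg_cst|exact: cvgMl_tmp].
have sum1 (f : nat -> nat) (g : nat -> R) a b :
    \sum_(a <= l < b) beta ^+ f l * g l @[beta --> (1 : R)^'-] --> \sum_(a <= l < b) g l.
  under [X in _ --> X]eq_bigr => l _ do rewrite -[g l]mul1r.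
  apply: cvg_big => [|l _]; first exact: add_continuous.
  by apply: cvgMr_tmp; exact: bX.
have den : 1 + p * beta * \sum_(0 <= l < k) beta ^+ l @[beta --> (1 : R)^'-] -->
    1 + k%:R * p.
  apply: cvgD; first exact: cvg_cst.
  rewrite [X in _ --> X](_ : _ = p * 1 * \sum_(0 <= l < k) 1); last first.
    by rewrite sumr_const_nat subn0 -mulr_natl; ring.
  apply: cvgM; first exact: cvgMl_tmp.
  by apply: cvg_big => [|l _]; [exact: add_continuous|exact: bX].
have -> : threshold_gain lambda mu c k nu / p =
    (cost_sum c k + 1 * (tail_sum q c k.+1 + lambda * nu * p^-1)) / (1 + k%:R * p).
  by rewrite /threshold_gain; field; rewrite !gt_eqF.
apply: cvgM; last by apply: cvgV den; rewrite gt_eqF.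
apply: cvgD; first exact: sum1.
apply: cvgM; first exact: bX.
apply: cvgD; first exact: tail_sum_discount_cvg.
by apply: cvgMl_tmp; apply: cvgV qb; rewrite gt_eqF.
Qed.

(** In V(k+1) - V(1) the coefficient of V(1) is p beta / (1 - q beta) - 1 = -(1 - beta) / (1 - q
    beta), so V(1) enters only through [scaled_value1]. *)
Lemma marginal_value_cvg (c : nat -> R) k nu :
  nonneg_nondecreasing c -> tail_summable q c ->
  beta * mu * (discounted_value lambda mu c k nu beta k.+1 -
      discounted_value1 lambda mu c k nu beta) - nu @[beta --> 1^'-] -->
    (mp_index lambda mu c k - nu) / (1 + k%:R * p).
Proof.
move=> hc hs; rewrite -(relative_value_threshold hlambda hmu) relative_value_gt//.
have b1 : beta @[beta --> (1 : R)^'-] --> (1 : R) by apply: cvg_at_left_filter; exact: cvg_id.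
have h : beta * mu * (tail_sum (q * beta) c k.+1 + lambda * nu / (1 - q * beta) -
      scaled_value1 lambda mu c k nu beta) - nu @[beta --> (1 : R)^'-] -->
    1 * mu * (tail_sum q c k.+1 + lambda * nu / (1 - q * 1) -
      threshold_gain lambda mu c k nu / p) - nu.
  apply: cvgB; last exact: cvg_cst.
  apply: cvgM; first exact: cvgMr_tmp.
  apply: cvgB; last exact: scaled_value1_cvg.
  apply: cvgD; first exact: tail_sum_discount_cvg.
  apply: cvgMl_tmp; apply: cvgV; first by rewrite mulr1 subKr gt_eqF.
  by apply: cvgB; [exact: cvg_cst|exact: cvgMl_tmp].
have -> : nu / mu = lambda * nu / (1 - q * 1).
  by rewrite mulr1 subKr; field; rewrite !gt_eqF.
rewrite mul1r in h; apply: cvg_trans h; apply: near_eq_cvg; near=> beta.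
have b0 : 0 < beta by near: beta; exact: nbhs_left_gt.
have lt1 : beta < 1 by near: beta; exact: nbhs_left_lt.
have qb1 : 0 < 1 - q * beta.
  have hb : 0 < beta <= 1 by rewrite b0 ltW.
  by case/andP: (discounted_failure_bounds hlambda hmu hb); rewrite subr_gt0.
rewrite /discounted_value threshold_value_gt// /tail_value /discounted_value1.
set Y := scaled_value1 _ _ _ _ _ _; congr (_ * _ - _).
by field; rewrite subr_eq0 !gt_eqF.
Unshelve. all: by end_near. Qed.

Lemma discounted_marginal (c : nat -> R) k nu beta i :
  nonneg_nondecreasing c -> tail_summable q c -> 0 <= nu ->
  0 < beta < 1 -> (0 < i)%N ->
  (discounted lambda mu beta (stage_cost c nu) (act_then_threshold false k) (true, i) -
   discounted lambda mu beta (stage_cost c nu) (act_then_threshold true k) (true, i))%E =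
  (beta * mu * (discounted_value lambda mu c k nu beta i.+1 -
      discounted_value1 lambda mu c k nu beta) - nu)%:E.
Proof.
move=> hc hs nu0 hb i0; rewrite !discounted_act_then_threshold// -EFinB.
by congr (_%:E) => /=; ring.
Qed.

(** The marginal cost is the case of charge 0, with limit m_i / (1 + i p). The marginal work is, up
    to sign, the case of zero costs and charge 1, with limit 1 / (1 + i p). *)
Lemma mp_index_is_mp_index (c : nat -> R) i :
  nonneg_nondecreasing c -> tail_summable q c -> (0 < i)%N ->
  is_mp_index lambda mu c i (mp_index lambda mu c i).
Proof.
move=> hc hs i0; have ip0 := kp0 i.
have costE : aoi_cost c = stage_cost c 0.
  by apply/funext => s; apply/funext => a; rewrite /stage_cost mul0r addr0.
have workE : attempt = stage_cost (fun=> 0 : R) 1.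
  by apply/funext => s; apply/funext => a; rewrite /stage_cost mul1r add0r.
exists (mp_index lambda mu c i / (1 + i%:R * p)), (1 / (1 + i%:R * p)); split.
- have := @marginal_value_cvg c i 0 hc hs; rewrite subr0 => h.
  apply: cvg_EFin.
    near=> beta; rewrite /disc_marginal_cost costE discounted_marginal//.
    by apply/andP; split; near: beta; [exact: nbhs_left_gt|exact: nbhs_left_lt].
  apply: cvg_trans h; apply: near_eq_cvg; near=> beta.
  rewrite /= /disc_marginal_cost costE discounted_marginal//.
  by apply/andP; split; near: beta; [exact: nbhs_left_gt|exact: nbhs_left_lt].
- have zc := zero_nonneg_nondecreasing (R := R).
  have zs := @tail_summable_zero R q.
  have /cvgN h := @marginal_value_cvg (fun=> 0) i 1 zc zs.
  have limE : 1 / (1 + i%:R * p) =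
      - ((mp_index lambda mu (fun=> 0) i - 1) / (1 + i%:R * p)).
    by rewrite /mp_index tail_sum_zero /cost_sum big1// mulr0 subr0 mulr0 sub0r mulNr opprK.
  rewrite limE.
  have margE beta : 0 < beta < 1 -> disc_marginal_work lambda mu i i beta =
      (- (beta * mu * (discounted_value lambda mu (fun=> 0) i 1 beta i.+1 -
        discounted_value1 lambda mu (fun=> 0) i 1 beta) - 1))%:E.
    move=> hb; rewrite EFinN -(discounted_marginal i zc zs ler01 hb i0).
    rewrite /disc_marginal_work workE !discounted_act_then_threshold//.
    by rewrite -!EFinB -EFinN opprB.
  apply: cvg_EFin.
    near=> beta; rewrite margE//.
    by apply/andP; split; near: beta; [exact: nbhs_left_gt|exact: nbhs_left_lt].
  apply: cvg_trans h; apply: near_eq_cvg; near=> beta.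
  rewrite /= margE//.
  by apply/andP; split; near: beta; [exact: nbhs_left_gt|exact: nbhs_left_lt].
- by rewrite divr_gt0.
by rewrite div1r invrK divfK// gt_eqF.
Unshelve. all: by end_near. Qed.

End MarginalProductivity.

(** * The summability hypothesis and the conclusion *)

Lemma tail_summable_of_series (R : realType) (r : R) (c : nat -> R) : 0 <= r ->
  (forall i, (0 < i)%N -> 0 <= c i) ->
  (\sum_(1 <= i <oo) (c i * r ^+ i)%:E < +oo)%E -> tail_summable r c.
Proof.
(* For r = 0 all terms of the series vanish, and a nonempty partial sum reduces to its first
   cost. *)
move=> r0 c0 csum x x0; have [r00|rn0] := eqVneq r 0.
  exists (c x) => -[|N]; first by rewrite /partial_sum big_geq// c0.
  by rewrite partial_sumS r00 mul0r addr0.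
have rp : 0 < r by rewrite lt_def rn0.
set s := (\sum_(1 <= i <oo) _)%E in csum.
have term0 i : (1 <= i)%N -> true -> (0 <= (c i * r ^+ i)%:E)%E.
  by move=> i1 _; rewrite lee_fin mulr_ge0 ?exprn_ge0// c0.
have s0 : (0 <= s)%E by apply: nneseries_ge0.
have sfin : s \is a fin_num by rewrite ge0_fin_numE.
(* Multiplied by r^x, the partial sum from x is a block of terms of the series. *)
exists (fine s / r ^+ x) => N; rewrite ler_pdivlMr ?exprn_gt0//.
rewrite -lee_fin fineK//; apply: le_trans (nneseries_lim_ge (x + N) term0).
rewrite sumEFin lee_fin /partial_sum mulr_suml.
rewrite [leRHS](@big_cat_nat _ _ _ x)//= ?leq_addr//.
rewrite -[X in X <= _]add0r lerD//.
  by rewrite big_nat_cond sumr_ge0// => i /andP[/andP[i1 _] _]; exact: term0.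
rewrite -[X in _ <= \sum_(X <= _ < _) _]add0n big_addn addKn le_eqVlt; apply/orP; left; apply/eqP.
by apply: eq_bigr => n _; rewrite (addnC n) exprD; ring.
Qed.

Theorem proposition4 (R : realType) (lambda mu : R) (c : nat -> R)
    (hlambda : 0 < lambda <= 1) (hmu : 0 < mu <= 1)
    (hc0 : forall i, (0 < i)%N -> 0 <= c i)
    (hcmono : forall i j, (0 < i)%N -> (i <= j)%N -> c i <= c j)
    (hcsum : (\sum_(1 <= i <oo) (c i * (1 - lambda * mu) ^+ i)%:E < +oo)%E) :
  threshold_indexable lambda mu c /\
  forall nus : nat -> R, whittle_index lambda mu c nus ->
    forall i, (0 < i)%N -> is_mp_index lambda mu c i (nus i).
Proof.
have hc : nonneg_nondecreasing c by split.
have q0 : 0 <= 1 - lambda * mu.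
  by rewrite subr_ge0; case/andP: (success_prob_bounds hlambda hmu).
have hs := tail_summable_of_series q0 hc0 hcsum.
split.
  split; last exact: threshold_optimal.
  by exists (mp_index lambda mu c); exact: whittle_mp_index.
move=> nus Wnus i i0.
rewrite (whittle_index_unique hlambda hmu hc hs Wnus i0).
exact: mp_index_is_mp_index.
Qed.
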